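(* Let $\tau$ be selected uniformly from $\mathbb{S}^2_{(2,3,\infty)}$. The probability distribution function of the Teichmüller distance $d_{\mathbb{S}^2_{(2,3,\infty)}}(\tau,i^* )$ is the Hölder continuous function $T:[0,\infty)\to\mathbb{R}$ given by $$T(r)=3\sinh(r)\qquad\text{for } 0\le r\le\sinh^{-1}\big(\tfrac12\big),$$ $$T(r)=\sinh(r)\left[3-\frac6\pi\tan^{-1}\left[\frac{4\cosh(r)\sqrt{2\cosh(2r)-3}}{7-3\cosh(2r)}\right]\right]\qquad\text{for }\sinh^{-1}\big(\tfrac12\big)\le r\le\sinh^{-1}\big(\tfrac1{\sqrt3}\big),$$ $$T(r)=\frac3\pi\sinh(r)\tan^{-1}\left[\frac{4\left(1-\cosh(2r)-\cosh(r)\sqrt{2\cosh(2r)-3}\right)}{5\cosh(2r)-2\cosh(4r)-8\sinh^2(r)\cosh(r)\sqrt{2\cosh(2r)-3}+1}\right]\qquad\text{for } r\ge\sinh^{-1}\big(\tfrac1{\sqrt3}\big).$$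
   Context: Let $\mathbb{H}^2=\{z\in\mathbb{C}:\Im z>0\}$ with the hyperbolic metric of curvature $-1$ (area form $|dz|^2/(\Im z)^2$), and let $\mathbb{S}^2_{(2,3,\infty)}=\mathbb{H}^2/PSL(2,\mathbb{Z})$ with the induced metric $d_{\mathbb{S}^2_{(2,3,\infty)}}$; it has hyperbolic area $\pi/3$ and is the moduli space of lattices $\Lambda_\tau=\{z\mapsto z+m+n\tau:m,n\in\mathbb Z\}$ of $\mathbb{C}$ (equivalently of punctured tori), the metric being the Teichmüller metric. ''Uniformly'' means with respect to normalised hyperbolic area; a fundamental domain is $\Omega=\{z:\Im z>0,\ |z|\ge1,\ -\frac12<\Re z\le\frac12\}$. The point $i^*$ is the projection of $i\in\mathbb{H}^2$, i.e. the cone point of order two, which corresponds to the square lattice. $\tan^{-1}$ is the principal branch, with values in $(-\pi/2,\pi/2)$. ''Probability distribution function'' means probability density function. *)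

(* Defs.v *)
From HB Require Import structures.
From mathcomp Require Import all_boot all_order all_algebra.
From mathcomp Require Import all_classical all_reals all_analysis.
From mathcomp.real_closed Require Import complex.

Set Implicit Arguments.
Unset Strict Implicit.
Unset Printing Implicit Defensive.

Import Order.TTheory GRing.Theory Num.Theory.
Import numFieldNormedType.Exports.

Local Open Scope classical_set_scope.
Local Open Scope ring_scope.

Definition sinh {R : realType} (x : R) : R := (expR x - expR (- x)) / 2.

Definition cosh {R : realType} (x : R) : R := (expR x + expR (- x)) / 2.

Definition arsinh {R : realType} (x : R) : R := ln (x + Num.sqrt (x ^+ 2 + 1)).

Section hyperbolic_plane.
Variable R : realType.

Definition half_plane : Type := {z : R[i] | 0 < complex.Im z}.

Definition half_plane_i : half_plane :=
  exist (fun z : R[i] => 0 < complex.Im z) (Complex 0 1) ltr01.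

HB.instance Definition _ := Choice.on half_plane.
HB.instance Definition _ := isPointed.Build half_plane half_plane_i.

Definition re (z : half_plane) : R := complex.Re (sval z).

Definition im (z : half_plane) : R := complex.Im (sval z).

Definition coords (z : half_plane) : measurableTypeR R * measurableTypeR R :=
  (re z, im z).

(* Every C^1 path on [0, 1] in the half-plane extends to a C^1 path on R, so
   asking for regularity on the whole line loses no path. *)
Definition C1_path (g : R -> half_plane) : Prop :=
  [/\ forall t, derivable (re \o g) t 1,
      forall t, derivable (im \o g) t 1,
      continuous (derive1 (re \o g)) &
      continuous (derive1 (im \o g))].

(* Length of g on [0, 1] for the metric |dz| / Im z, of curvature -1. *)
Definition hyp_length (g : R -> half_plane) : R :=
  \int[lebesgue_measure]_(t in `[0, 1])
    (Num.sqrt (derive1 (re \o g) t ^+ 2 + derive1 (im \o g) t ^+ 2) / im (g t)).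

Definition hyp_dist (z w : half_plane) : R :=
  inf [set hyp_length g | g in [set g | [/\ C1_path g, g 0 = z & g 1 = w]]].

Definition hyp_area (A : set half_plane) : \bar R :=
  \int[(@lebesgue_measure R \x @lebesgue_measure R)%E]_(p in coords @` A)
    (p.2 ^- 2)%:E.

End hyperbolic_plane.

Section modular_surface.
Variable R : realType.

(* A matrix and its opposite induce the same Moebius map, so the orbits of
   SL(2, Z) are those of PSL(2, Z). *)
Definition modular_orbit (z : half_plane R) : set (half_plane R) :=
  [set w | exists2 M : 'M[int]_2, \det M = 1 &
     sval w = ((M 0 0)%:~R * sval z + (M 0 1)%:~R) /
              ((M 1 0)%:~R * sval z + (M 1 1)%:~R)].

(* A point of the quotient, seen as the set of its lifts to the half-plane. *)
Definition modular_surface : Type :=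
  {O : set (half_plane R) | exists z, O = modular_orbit z}.

Definition lifts (p : modular_surface) : set (half_plane R) := sval p.

Definition modular_proj (z : half_plane R) : modular_surface :=
  exist (fun O => exists z, O = modular_orbit z) (modular_orbit z)
    (ex_intro _ z erefl).

Definition i_star : modular_surface := modular_proj (half_plane_i R).

HB.instance Definition _ := gen_eqMixin modular_surface.
HB.instance Definition _ := gen_choiceMixin modular_surface.
HB.instance Definition _ := isPointed.Build modular_surface i_star.

(* Quotient sigma-algebra: Borel sets lift to Borel sets of the half-plane. *)
Definition modular_measurable : set (set modular_surface) :=
  [set A | g_sigma_algebra_preimage (@coords R) (modular_proj @^-1` A)].

Fact modular_measurable0 : modular_measurable set0.
Proof.
rewrite /modular_measurable /= preimage_set0.
exact: (@measurable0 _ (g_sigma_algebra_preimageType (@coords R))).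
Qed.

Fact modular_measurableC A :
  modular_measurable A -> modular_measurable (~` A).
Proof.
rewrite /modular_measurable /= preimage_setC.
exact: (@measurableC _ (g_sigma_algebra_preimageType (@coords R))).
Qed.

Fact modular_measurable_bigcup (F : (set modular_surface)^nat) :
  (forall i, modular_measurable (F i)) -> modular_measurable (\bigcup_i F i).
Proof.
rewrite /modular_measurable /= preimage_bigcup.
exact: (@bigcupT_measurable _ (g_sigma_algebra_preimageType (@coords R))).
Qed.

HB.instance Definition _ := @isMeasurable.Build default_measure_display
  modular_surface modular_measurable modular_measurable0 modular_measurableC
  modular_measurable_bigcup.

(* The metric induced on the quotient by a group of isometries. *)
Definition modular_dist (p q : modular_surface) : R :=
  inf [set hyp_dist z w | z in lifts p & w in lifts q].

Definition fundamental_domain : set (half_plane R) :=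
  [set z | [/\ 1 <= `|sval z|, - 2^-1 < re z & re z <= 2^-1]].

Definition modular_area (A : set modular_surface) : \bar R :=
  hyp_area (fundamental_domain `&` modular_proj @^-1` A).

Definition uniformly_distributed d (Omega : measurableType d)
    (P : probability Omega R) (tau : {RV P >-> modular_surface}) : Prop :=
  forall A : set modular_surface, measurable A ->
    distribution P tau A = (modular_area A / modular_area setT)%E.

End modular_surface.

Section real_functions.
Variable R : realType.

Definition hoelder_continuous_on (D : set R) (f : R -> R) : Prop :=
  exists a C : R, [/\ 0 < a, a <= 1 &
    forall x y, D x -> D y -> `|f x - f y| <= C * `|x - y| `^ a].

Definition has_density_on d (Omega : measurableType d)
    (P : probability Omega R) (X : Omega -> R) (D : set R) (f : R -> R) : Prop :=
  [/\ measurable_fun [set: Omega] X,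
      measurable_fun D f,
      forall x, D x -> 0 <= f x &
      forall B : set R, measurable B ->
        P (X @^-1` B) = (\int[lebesgue_measure]_(x in B `&` D) (f x)%:E)%E].

End real_functions.

(* Main.v *)
(** The Dirichlet cell of [i] for [SL(2, Z)] contains the fundamental domain
    [|z| >= 1], [|Re z| <= 1/2]: the squared norm [|az + b|^2 + |cz + d|^2] of a
    unimodular matrix applied to [(z, 1)] is minimal at the identity, where it
    equals [|z|^2 + 1 = 2 (Im z) cosh (dist z i)].  Hence the points at distance
    less than [r] from [i*] are those of the fundamental domain in the Euclidean
    disc of centre [i cosh r] and radius [sinh r].  Integrating [dx dy / y^2]
    over this region, first in [y] and then in [x], gives its area in closed form:
    [pi (cosh r - 1)], minus twice [cosh r * theta - atan w] for each of the two
    ends cut off by [|Re z| <= 1/2], where [w = sqrt (4 sinh^2 r - 1)] and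
    [theta = atan (w / cosh r)].  Once the circle [|z| = 1] is exhausted
    ([3 sinh^2 r >= 1]), one of the two ends keeps the constant angle
    [atan (1/2)].  As [theta' = 1 / (w sinh r)], the derivative of
    [cosh r * theta - atan w] is just [theta sinh r], which gives the density
    [sinh r * (3 - 6/pi * (theta + min theta (atan (1/2))))]. *)
From HB Require Import structures.
Require Import Defs.
From mathcomp Require Import all_boot all_order all_algebra.
From mathcomp Require Import all_classical all_reals all_analysis.
From mathcomp Require Import measurable_realfun zify ring lra.
From mathcomp.real_closed Require Import complex.

Import Order.TTheory GRing.Theory Num.Theory.
Import numFieldNormedType.Exports.

Local Open Scope classical_set_scope.
Local Open Scope ring_scope.

(** * Calculus rules *)

(** [hyp_dist] is an infimum of lengths, so its closed form needs two bounds: every path is at least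
    as long as the formula says, and an explicit geodesic attains it. [modular_dist] is again an
    infimum, over pairs of lifts. To be below [r] it needs one good pair, hence one unimodular
    matrix; as these are countably many, balls are measurable before the geometry of the domain is
    used. The thresholds are the radii at which the Euclidean disc reaches [|x| = 1/2]
    ([sinh r = 1/2]) and at which its intersection with the unit circle, at [|x| = tanh r], reaches
    it ([3 sinh^2 r = 1]). The total area [pi / 3] accounts for the factor [3 / pi]. The area of a
    ball is never differentiated in [r]: area and density are both integrated in closed form, and
    equal distribution functions give equal laws. The stated arctangents come from subtraction and
    doubling formulas, whose principal branch has to be checked on each range. Hoelder continuity on
    an unbounded half-line needs the decay of the angular factor to offset the growth of [sinh]. *)

Section derivative_rules.
Context {R : realType}.
Implicit Types (f g : R -> R) (x a b : R).

(** Separates the derivative built by the rules from the one claimed, so that what remains is an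
    algebraic identity. *)
Lemma derive_rule_eq f x a b : is_derive x 1 f a -> a = b -> is_derive x 1 f b.
Proof. by move=> fa <-. Qed.

Lemma derive_rule_cst c x : is_derive x 1 (fun=> c : R) 0.
Proof. exact: is_derive_cst. Qed.

Lemma derive_rule_id x : is_derive x 1 (fun t : R => t) 1.
Proof. exact: is_derive_id. Qed.

Lemma derive_rule_add f g x a b : is_derive x 1 f a -> is_derive x 1 g b ->
  is_derive x 1 (fun t => f t + g t) (a + b).
Proof. move=> fa gb; exact: is_deriveD. Qed.

Lemma derive_rule_opp f x a : is_derive x 1 f a ->
  is_derive x 1 (fun t => - f t) (- a).
Proof. move=> fa; exact: is_deriveN. Qed.

Lemma derive_rule_mul f g x a b : is_derive x 1 f a -> is_derive x 1 g b ->
  is_derive x 1 (fun t => f t * g t) (f x * b + g x * a).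
Proof. move=> fa gb; exact: is_deriveM. Qed.

Lemma derive_rule_exp f n x a : is_derive x 1 f a ->
  is_derive x 1 (fun t => f t ^+ n) (n%:R * f x ^+ n.-1 * a).
Proof.
move=> fa; have -> : (fun t => f t ^+ n) = f ^+ n by rewrite exprfctE.
exact: is_deriveX.
Qed.

Lemma derive_rule_inv f x a : f x != 0 -> is_derive x 1 f a ->
  is_derive x 1 (fun t => (f t)^-1) (- (f x) ^- 2 * a).
Proof. by move=> fx0 fa; exact: is_deriveV. Qed.

Lemma derive_rule_comp h f x a b : is_derive (f x) 1 h b -> is_derive x 1 f a ->
  is_derive x 1 (fun t => h (f t)) (b * a).
Proof. by move=> hb fa; exact: (@is_derive1_comp _ h f). Qed.

Lemma derive_rule_expR f x a : is_derive x 1 f a ->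
  is_derive x 1 (fun t => expR (f t)) (expR (f x) * a).
Proof. by move=> fa; apply: derive_rule_comp. Qed.

Lemma derive_rule_ln f x a : 0 < f x -> is_derive x 1 f a ->
  is_derive x 1 (fun t => ln (f t)) ((f x)^-1 * a).
Proof. by move=> f0 fa; apply: derive_rule_comp; exact: is_derive1_ln. Qed.

Lemma derive_rule_atan f x a : is_derive x 1 f a ->
  is_derive x 1 (fun t => atan (f t)) ((1 + f x ^+ 2)^-1 * a).
Proof. by move=> fa; apply: derive_rule_comp. Qed.

Lemma derive_rule_sqrt f x a : 0 < f x -> is_derive x 1 f a ->
  is_derive x 1 (fun t => Num.sqrt (f t)) ((2 * Num.sqrt (f x))^-1 * a).
Proof. by move=> f0 fa; apply: derive_rule_comp; exact: is_derive1_sqrt. Qed.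

Lemma is_derive_continuous f x a : is_derive x 1 f a -> {for x, continuous f}.
Proof.
by move=> [fx _]; apply/differentiable_continuous/derivable1_diffP.
Qed.

Lemma is_derive_derive1 f x a : is_derive x 1 f a -> derive1 f x = a.
Proof. by move=> fa; rewrite derive1E derive_val. Qed.

Lemma derive_rule_cosh f x a : is_derive x 1 f a ->
  is_derive x 1 (fun t => cosh (f t)) (sinh (f x) * a).
Proof.
move=> fa; rewrite /cosh /sinh.
have dN := derive_rule_expR _ _ _ (derive_rule_opp _ _ _ fa).
have d := derive_rule_add _ _ _ _ _ (derive_rule_expR _ _ _ fa) dN.
by apply: derive_rule_eq (derive_rule_mul _ _ _ _ _ d (derive_rule_cst _ _))
  _; ring.
Qed.

Lemma derive_rule_sinh f x a : is_derive x 1 f a ->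
  is_derive x 1 (fun t => sinh (f t)) (cosh (f x) * a).
Proof.
move=> fa; rewrite /cosh /sinh.
have dN := derive_rule_expR _ _ _ (derive_rule_opp _ _ _ fa).
have d := derive_rule_add _ _ _ _ _ (derive_rule_expR _ _ _ fa)
  (derive_rule_opp _ _ _ dN).
by apply: derive_rule_eq (derive_rule_mul _ _ _ _ _ d (derive_rule_cst _ _))
  _; ring.
Qed.

End derivative_rules.

(** Known derivatives in the context take precedence over the structural rules. As [is_derive] is a
    class, [notypeclasses refine] keeps instance resolution from filling the premises. *)
Ltac derive_step := match goal with
  | df : is_derive _ _ ?f _ |- is_derive _ _ ?f _ => exact df
  | df : is_derive _ _ ?f _ |- is_derive _ _ (fun t => ?f t) _ => exact df
  | |- is_derive _ _ (fun=> ?c) _ => notypeclasses refine (derive_rule_cst _ _)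
  | |- is_derive _ _ (fun t => t) _ => notypeclasses refine (derive_rule_id _)
  | |- is_derive _ _ (fun t => cosh (@?f t)) _ =>
      notypeclasses refine (derive_rule_cosh f _ _ _)
  | |- is_derive _ _ (fun t => sinh (@?f t)) _ =>
      notypeclasses refine (derive_rule_sinh f _ _ _)
  | |- is_derive _ _ (fun t => expR (@?f t)) _ =>
      notypeclasses refine (derive_rule_expR f _ _ _)
  | |- is_derive _ _ (fun t => ln (@?f t)) _ =>
      notypeclasses refine (derive_rule_ln f _ _ _ _)
  | |- is_derive _ _ (fun t => atan (@?f t)) _ =>
      notypeclasses refine (derive_rule_atan f _ _ _)
  | |- is_derive _ _ (fun t => Num.sqrt (@?f t)) _ =>
      notypeclasses refine (derive_rule_sqrt f _ _ _ _)
  | |- is_derive _ _ (fun t => @?f t + @?g t) _ =>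
      notypeclasses refine (derive_rule_add f g _ _ _ _ _)
  | |- is_derive _ _ (fun t => - @?f t) _ =>
      notypeclasses refine (derive_rule_opp f _ _ _)
  | |- is_derive _ _ (fun t => @?f t * @?g t) _ =>
      notypeclasses refine (derive_rule_mul f g _ _ _ _ _)
  | |- is_derive _ _ (fun t => @?f t ^+ ?n) _ =>
      notypeclasses refine (derive_rule_exp f n _ _ _)
  | |- is_derive _ _ (fun t => (@?f t)^-1) _ =>
      notypeclasses refine (derive_rule_inv f _ _ _ _)
  end.

Ltac derive_tac :=
  notypeclasses refine (derive_rule_eq _ _ _ _ _ _); [repeat derive_step|];
  lazy beta.

Section continuity_rules.
Context {R : realType}.
Implicit Types (f g h : R -> R) (x : R).

Lemma continuous_rule_cst (c : R) x : continuous_at x (fun=> c : R).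
Proof. exact: cst_continuous. Qed.

Lemma continuous_rule_id x : continuous_at x (fun t : R => t).
Proof. by move=> A; exact. Qed.

Lemma continuous_rule_comp h f x : continuous h -> continuous_at x f ->
  continuous_at x (fun t => h (f t)).
Proof. by move=> ch cf; apply: (@continuous_comp _ _ _ f h) => //;
  exact: ch. Qed.

Lemma continuous_rule_add f g x : continuous_at x f ->
  continuous_at x g -> continuous_at x (fun t => f t + g t).
Proof. exact: continuousD. Qed.

Lemma continuous_rule_opp f x : continuous_at x f ->
  continuous_at x (fun t => - f t).
Proof. exact: continuousN. Qed.

Lemma continuous_rule_mul f g x : continuous_at x f ->
  continuous_at x g -> continuous_at x (fun t => f t * g t).
Proof. exact: continuousM. Qed.

Lemma continuous_rule_exp f n x : continuous_at x f ->
  continuous_at x (fun t => f t ^+ n).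
Proof.
move=> cf; apply: (continuous_rule_comp (fun y => y ^+ n)) => //.
exact: exprn_continuous.
Qed.

Lemma continuous_rule_inv f x : f x != 0 -> continuous_at x f ->
  continuous_at x (fun t => (f t)^-1).
Proof. exact: continuousV. Qed.

Lemma continuous_rule_sqrt f x : continuous_at x f ->
  continuous_at x (fun t => Num.sqrt (f t)).
Proof. by move=> cf; apply: (continuous_rule_comp Num.sqrt) => //;
  exact: sqrt_continuous. Qed.

Lemma continuous_rule_atan f x : continuous_at x f ->
  continuous_at x (fun t => atan (f t)).
Proof. by move=> cf; apply: (continuous_rule_comp atan) => // t;
  exact: continuous_atan. Qed.

Lemma continuous_cosh : continuous (@cosh R).
Proof.
by move=> x; apply: is_derive_continuous; apply: derive_rule_cosh.
Qed.

Lemma continuous_sinh : continuous (@sinh R).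
Proof.
by move=> x; apply: is_derive_continuous; apply: derive_rule_sinh.
Qed.

Lemma continuous_rule_cosh f x : continuous_at x f ->
  continuous_at x (fun t => cosh (f t)).
Proof. by move=> cf; apply: (continuous_rule_comp cosh) => //;
  exact: continuous_cosh. Qed.

Lemma continuous_rule_sinh f x : continuous_at x f ->
  continuous_at x (fun t => sinh (f t)).
Proof. by move=> cf; apply: (continuous_rule_comp sinh) => //;
  exact: continuous_sinh. Qed.

End continuity_rules.

Ltac continuous_step := match goal with
  | cf : continuous_at _ ?f |- continuous_at _ ?f => exact cf
  | cf : continuous_at _ ?f |- continuous_at _ (fun t => ?f t) => exact cf
  | |- continuous_at _ (fun=> ?c) =>
    notypeclasses refine (continuous_rule_cst _ _)
  | |- continuous_at _ (fun t => t) =>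
    notypeclasses refine (continuous_rule_id _)
  | |- continuous_at _ (fun t => cosh (@?f t)) =>
      notypeclasses refine (continuous_rule_cosh f _ _)
  | |- continuous_at _ (fun t => sinh (@?f t)) =>
      notypeclasses refine (continuous_rule_sinh f _ _)
  | |- continuous_at _ (fun t => atan (@?f t)) =>
      notypeclasses refine (continuous_rule_atan f _ _)
  | |- continuous_at _ (fun t => Num.sqrt (@?f t)) =>
      notypeclasses refine (continuous_rule_sqrt f _ _)
  | |- continuous_at _ (fun t => @?f t + @?g t) =>
      notypeclasses refine (continuous_rule_add f g _ _ _)
  | |- continuous_at _ (fun t => - @?f t) =>
      notypeclasses refine (continuous_rule_opp f _ _)
  | |- continuous_at _ (fun t => @?f t * @?g t) =>
      notypeclasses refine (continuous_rule_mul f g _ _ _)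
  | |- continuous_at _ (fun t => @?f t ^+ ?n) =>
      notypeclasses refine (continuous_rule_exp f n _ _)
  | |- continuous_at _ (fun t => (@?f t)^-1) =>
      notypeclasses refine (continuous_rule_inv f _ _ _)
  end.
Ltac continuous_tac := repeat continuous_step; lazy beta.

(** * Hyperbolic functions and their inverses *)

Section hyperbolic_functions.
Context {R : realType}.
Implicit Types x y r : R.

Lemma cosh_ge1 r : 1 <= cosh r.
Proof.
have e0 := expR_gt0 r.
rewrite /cosh expRN ler_pdivlMr// mul1r.
have h : expR r * (expR r)^-1 = 1 by rewrite divff// gt_eqF.
have i0 : 0 < (expR r)^-1 by rewrite invr_gt0.
have := sqr_ge0 (expR r - (expR r)^-1); nra.
Qed.

Lemma cosh_gt0 r : 0 < cosh r.
Proof. exact: lt_le_trans (cosh_ge1 r). Qed.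

Lemma cosh2Dsinh2 r : cosh r ^+ 2 = 1 + sinh r ^+ 2.
Proof.
rewrite /cosh /sinh expRN; field.
by rewrite gt_eqF// expR_gt0.
Qed.

Lemma sinh0 : sinh 0 = 0 :> R.
Proof. by rewrite /sinh oppr0 subrr mul0r. Qed.

Lemma cosh0 : cosh 0 = 1 :> R.
Proof. by rewrite /cosh oppr0 expR0; field. Qed.

Lemma lt_sinh : {mono (@sinh R) : x y / x < y}.
Proof.
apply: leW_mono; apply: le_mono => x y xy; rewrite /sinh ltr_pM2r ?invr_gt0//.
by rewrite ltrB// ltr_expR ?ltrN2.
Qed.

Lemma le_sinh : {mono (@sinh R) : x y / x <= y}.
Proof. by move=> x y; rewrite !leNgt lt_sinh. Qed.

Lemma sinh_ge0 r : 0 <= r -> 0 <= sinh r.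
Proof. by rewrite -le_sinh sinh0. Qed.

Lemma sinh_gt0 r : 0 < r -> 0 < sinh r.
Proof. by rewrite -lt_sinh sinh0. Qed.

Lemma arsinhK x : sinh (arsinh x) = x.
Proof.
have h0 : 0 <= x ^+ 2 + 1 by rewrite addr_ge0// sqr_ge0.
set q := Num.sqrt (x ^+ 2 + 1).
have q2 : q ^+ 2 = x ^+ 2 + 1 by rewrite sqr_sqrtr.
have q0 : 0 <= q by exact: sqrtr_ge0.
have pos : 0 < x + q by nra.
rewrite /arsinh /sinh expRN lnK ?posrE// -/q.
have -> : (x + q)^-1 = q - x.
  apply: (mulfI (x := x + q)); first by rewrite gt_eqF.
  by rewrite divff ?gt_eqF//; ring: q2.
by field.
Qed.

Lemma le_cosh x y : 0 <= x -> 0 <= y -> (cosh x <= cosh y) = (x <= y).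
Proof.
move=> x0 y0.
rewrite -(@ler_pXn2r _ 2) ?nnegrE ?(ltW (cosh_gt0 _))// !cosh2Dsinh2 lerD2l.
by rewrite ler_pXn2r ?nnegrE ?sinh_ge0// le_sinh.
Qed.

Lemma lt_cosh x y : 0 <= x -> 0 <= y -> (cosh x < cosh y) = (x < y).
Proof. by move=> x0 y0; rewrite !ltNge le_cosh. Qed.

Lemma cosh_double r : cosh (2 * r) = 2 * sinh r ^+ 2 + 1.
Proof.
have -> : 2 * r = r + r by ring.
rewrite /cosh /sinh opprD !expRD expRN; field.
by rewrite gt_eqF// expR_gt0.
Qed.

(* Only meaningful for x >= 1. *)
Definition arcosh x : R := ln (x + Num.sqrt (x ^+ 2 - 1)).

Lemma arcoshK x : 1 <= x -> cosh (arcosh x) = x.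
Proof.
move=> x1.
have h0 : 0 <= x ^+ 2 - 1 by nra.
set q := Num.sqrt (x ^+ 2 - 1).
have q2 : q ^+ 2 = x ^+ 2 - 1 by rewrite sqr_sqrtr.
have q0 : 0 <= q by exact: sqrtr_ge0.
have pos : 0 < x + q by nra.
rewrite /arcosh /cosh expRN lnK ?posrE// -/q.
have -> : (x + q)^-1 = x - q.
  apply: (mulfI (x := x + q)); first by rewrite gt_eqF.
  by rewrite divff ?gt_eqF//; ring: q2.
by field.
Qed.

Lemma arcosh_ge0 x : 1 <= x -> 0 <= arcosh x.
Proof.
move=> x1; rewrite /arcosh ln_ge0//.
by have := sqrtr_ge0 (x ^+ 2 - 1); lra.
Qed.

Lemma arcosh_lt x r : 1 <= x -> 0 < r -> (arcosh x < r) = (x < cosh r).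
Proof.
move=> x1 r0; rewrite -[in RHS](arcoshK x x1) lt_cosh//; last exact: ltW.
exact: arcosh_ge0.
Qed.

End hyperbolic_functions.

(** * The hyperbolic distance *)

Section hyperbolic_distance.
Context {R : realType}.
Implicit Types z w : half_plane R.

(** Equal to [1 + |z - w|^2 / (2 im z im w)], the classical expression of [cosh (hyp_dist z w)]; the
    link with lengths of paths is [hyp_distE]. *)
Definition cosh_dist z w : R :=
  ((re z - re w) ^+ 2 + im z ^+ 2 + im w ^+ 2) / (2 * im z * im w).

Lemma im_gt0 z : 0 < im z.
Proof. exact: (svalP z). Qed.

Lemma cosh_dist_ge1 z w : 1 <= cosh_dist z w.
Proof.
have z0 := im_gt0 z; have w0 := im_gt0 w.
have m0 : 0 < im z * im w by exact: mulr_gt0.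
rewrite /cosh_dist ler_pdivlMr; last by rewrite -mulrA mulr_gt0.
have := sqr_ge0 (re z - re w); have := sqr_ge0 (im z - im w); nra.
Qed.

(** * Every path is at least as long as the distance formula says *)

Section lower_bound.
Variables (g : R -> half_plane R) (gC1 : C1_path g).

Let X : R -> R := @re R \o g.
Let Y : R -> R := @im R \o g.
Let X' : R -> R := derive1 X.
Let Y' : R -> R := derive1 Y.
Let a := X 0.
Let b := Y 0.
Let speed (t : R) : R := Num.sqrt (X' t ^+ 2 + Y' t ^+ 2) / Y t.
(** [cosh_dist (g 0) (g t)]; [ch'] is its derivative. *)
Let ch (t : R) : R := ((X t - a) ^+ 2 + Y t ^+ 2 + b ^+ 2) * (2 * Y t * b)^-1.
Let ch' (t : R) : R := (2 * (X t - a) * Y t * X' t +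
   (Y t ^+ 2 - (X t - a) ^+ 2 - b ^+ 2) * Y' t) / (2 * Y t ^+ 2 * b).

Let Y_gt0 (t : R) : 0 < Y t. Proof. exact: im_gt0. Qed.
Let b_gt0 : 0 < b. Proof. exact: Y_gt0. Qed.

Let dX (t : R) : is_derive t 1 X (X' t).
Proof. by case: gC1 => dX _ _ _; rewrite /X' derive1E; exact/derivableP. Qed.

Let dY (t : R) : is_derive t 1 Y (Y' t).
Proof. by case: gC1 => _ dY _ _; rewrite /Y' derive1E; exact/derivableP. Qed.

Let cX : continuous X.
Proof. by move=> t; exact: is_derive_continuous (dX t). Qed.

Let cY : continuous Y.
Proof. by move=> t; exact: is_derive_continuous (dY t). Qed.

Let cX' : continuous X'. Proof. by case: gC1. Qed.

Let cY' : continuous Y'. Proof. by case: gC1. Qed.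

Let dch (t : R) : is_derive t 1 ch (ch' t).
Proof.
have b0 : b != 0 by rewrite gt_eqF.
have Y0 : Y t != 0 by rewrite gt_eqF.
have dXt := dX t; have dYt := dY t.
rewrite /ch; derive_tac.
  by rewrite !mulf_neq0.
by rewrite /ch' /=; field; rewrite b0 Y0.
Qed.

Let ch_ge1 (t : R) : 1 <= ch t.
Proof.
have m0 : 0 < Y t * b by rewrite mulr_gt0.
rewrite /ch ler_pdivlMr; last by rewrite -mulrA mulr_gt0.
have := sqr_ge0 (X t - a); have := sqr_ge0 (Y t - b); nra.
Qed.

(* Cauchy-Schwarz: the gradient of [cosh (dist (g 0) _)] has hyperbolic norm
   [sinh (dist (g 0) _)]. *)
Let ch'_le (t : R) : ch' t ^+ 2 <= speed t ^+ 2 * (ch t ^+ 2 - 1).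
Proof.
have b0 : b != 0 by rewrite gt_eqF.
have Y0 : Y t != 0 by rewrite gt_eqF.
have -> : speed t ^+ 2 = (X' t ^+ 2 + Y' t ^+ 2) / Y t ^+ 2.
  by rewrite expr_div_n sqr_sqrtr// addr_ge0 ?sqr_ge0.
rewrite -subr_ge0.
(* Lagrange's identity: the defect in the Cauchy-Schwarz inequality is the square of the determinant
   of gradient and velocity. *)
rewrite [leRHS](_ : _ = ((2 * (X t - a) * Y t * Y' t -
   (Y t ^+ 2 - (X t - a) ^+ 2 - b ^+ 2) * X' t) / (2 * Y t ^+ 2 * b)) ^+ 2).
  exact: sqr_ge0.
by rewrite /ch /ch'; field; rewrite b0 Y0.
Qed.

Let cch : continuous ch.
Proof. by move=> t; exact: is_derive_continuous (dch t). Qed.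

Let cspeed : continuous speed.
Proof.
move=> t; have cYt := cY t; have cX't := cX' t; have cY't := cY' t.
by rewrite /speed; continuous_tac; rewrite gt_eqF.
Qed.

Let cch' : continuous ch'.
Proof.
move=> t; have cXt := cX t; have cYt := cY t.
have cX't := cX' t; have cY't := cY' t.
by rewrite /ch'; continuous_tac; rewrite gt_eqF// !mulr_gt0// exprn_gt0.
Qed.

(* The primitive [ln (ch + sqrt (ch^2 - 1))] of the speed bound is not
   differentiable where [ch = 1], whence the [e ^+ 2] under the root. *)
Let length_ge (e : R) : 0 < e -> arcosh (ch 1) <= hyp_length g + e.
Proof.
move=> e0.
have rad_gt0 t : 0 < ch t ^+ 2 - 1 + e ^+ 2.
  by have := ch_ge1 t; have := exprn_gt0 2 e0; nra.
pose q (t : R) : R := Num.sqrt (ch t ^+ 2 - 1 + e ^+ 2).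
have q_gt0 t : 0 < q t by rewrite sqrtr_gt0.
have q2 t : q t ^+ 2 = ch t ^+ 2 - 1 + e ^+ 2 by rewrite sqr_sqrtr// ltW.
have arg_gt0 t : 0 < ch t + q t.
  by rewrite addr_gt0//; exact: lt_le_trans (ch_ge1 t).
pose F (t : R) : R := ln (ch t + q t).
pose F' (t : R) : R := ch' t / q t.
have dF (t : R) : is_derive t 1 F (F' t).
  have dcht := dch t.
  rewrite /F /q; derive_tac.
  - exact: arg_gt0.
  - exact: rad_gt0.
  rewrite -/(q t) /F' /=; field.
  by rewrite !gt_eqF// addrC.
have cF' : continuous F'.
  move=> t; have ccht := cch t; have cch't := cch' t.
  by rewrite /F' /q; continuous_tac; exact: lt0r_neq0 (q_gt0 t).
have F'_le t : F' t <= speed t.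
  have s0 : 0 <= speed t.
    by rewrite divr_ge0 ?sqrtr_ge0// ltW.
  rewrite ler_pdivrMr//; apply: le_trans (ler_norm _) _.
  rewrite -(@ler_pXn2r _ 2) ?nnegrE ?normr_ge0 ?(mulr_ge0 s0 (ltW (q_gt0 t)))//.
  rewrite real_normK ?num_real// [(speed t * q t) ^+ 2]exprMn q2.
  apply: (le_trans (ch'_le t)).
  by rewrite ler_wpM2l ?sqr_ge0// lerDl sqr_ge0.
have FE : (\int[lebesgue_measure]_(t in `[0%R, 1%R]) (F' t)%:E)%E =
    (F 1 - F 0)%:E.
  rewrite EFinB; apply: continuous_FTC2 => //.
  - exact: continuous_subspaceT.
  - split; first by move=> t _; case: (dF t).
    + apply: cvg_at_right_filter; exact: is_derive_continuous (dF 0).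
    + apply: cvg_at_left_filter; exact: is_derive_continuous (dF 1).
  - by move=> t _; exact: is_derive_derive1 (dF t).
have {}FE : (\int[lebesgue_measure]_(t in `[0, 1]) F' t) = F 1 - F 0.
  by rewrite /Rintegral FE.
have le_len : F 1 - F 0 <= hyp_length g.
  rewrite -FE /hyp_length; apply: le_Rintegral => //.
  - apply: continuous_compact_integrable; first exact: segment_compact.
    exact: continuous_subspaceT.
  - apply: continuous_compact_integrable; first exact: segment_compact.
    exact: continuous_subspaceT.
(* Since [ch 0 = 1], [F 0] is [ln (1 + e)]: this is the whole cost of the regularisation. *)
have F0 : F 0 <= e.
  have ch0 : ch 0 = 1.
    by rewrite /ch -/a -/b; field; rewrite gt_eqF.
  rewrite /F /q ch0 expr1n subrr add0r sqrtr_sqr gtr0_norm//.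
  by apply: le_trans (le_ln1Dx _) _ => //; rewrite (lt_trans _ e0)// ltrN10.
have : arcosh (ch 1) <= F 1.
  rewrite /arcosh ler_ln ?posrE//; first last.
    by apply: ltr_pwDl; [exact: lt_le_trans (ch_ge1 1)|exact: sqrtr_ge0].
  by rewrite lerD2l ler_wsqrtr// lerDl sqr_ge0.
lra.
Qed.

Lemma hyp_length_ge : arcosh (cosh_dist (g 0) (g 1)) <= hyp_length g.
Proof.
have -> : cosh_dist (g 0) (g 1) = ch 1.
  by rewrite /ch /cosh_dist /a /b /X /Y /=; field; rewrite !gt_eqF ?im_gt0.
by apply/ler_addgt0Pr => e e0; exact: length_ge.
Qed.

End lower_bound.

(* The vertical geodesic through [i], rotated around [i] and then moved to
   [(a, b)] by [z |-> b z + a]; [(A, B)] is the cosine and sine of the initial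
   direction. *)
Section geodesic.
Variables (a b A B d : R).
Hypotheses (b_gt0 : 0 < b) (d_ge0 : 0 <= d) (AB : A ^+ 2 + B ^+ 2 = 1).

Let A2 : A ^+ 2 = 1 - B ^+ 2. Proof. by rewrite -AB addrK. Qed.

(** Reciprocal of the imaginary part of the rotated point. A rotation matrix with angle [u] sends
    [i e^s] to height [1 / (sin^2 u e^s + cos^2 u e^-s)], and this denominator is
    [cosh s - B sinh s] with [B = cos (2 u)]. *)
Let D (t : R) : R := cosh (d * t) - B * sinh (d * t).

Let D_gt0 t : 0 < D t.
Proof.
have c0 := cosh_gt0 (d * t); have cs := cosh2Dsinh2 (d * t).
rewrite /D; have := sqr_ge0 (A * sinh (d * t)) => h.
have B1 : (B * sinh (d * t)) ^+ 2 < cosh (d * t) ^+ 2.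
  have -> : (B * sinh (d * t)) ^+ 2 = sinh (d * t) ^+ 2 - (A * sinh (d * t))
    ^+ 2.
    by ring: A2.
  by rewrite cs; lra.
rewrite subr_gt0; apply: le_lt_trans (ler_norm _) _.
by rewrite -(@ltr_pXn2r _ 2) ?nnegrE// ?(ltW c0)// real_normK ?num_real.
Qed.

Let y_gt0 t : 0 < b / D t. Proof. exact: divr_gt0. Qed.

Definition geodesic (t : R) : half_plane R :=
  exist (fun z : R[i] => 0 < complex.Im z)
    (Complex (a + b * (A * sinh (d * t)) / D t) (b / D t)) (y_gt0 t).

Let x' t := d * b * A / D t ^+ 2.
Let y' t := - (d * b * (sinh (d * t) - B * cosh (d * t))) / D t ^+ 2.

Let dre (t : R) : is_derive t 1 (@re R \o geodesic) (x' t).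
Proof.
have cs := cosh2Dsinh2 (d * t).
have D0 : D t != 0 by rewrite gt_eqF.
have -> : @re R \o geodesic =
  (fun t => a + b * (A * sinh (d * t)) / D t) by [].
rewrite /D; derive_tac => //.
move: D0; rewrite /x' /D => D0 /=.
by field: cs.
Qed.

Let dim (t : R) : is_derive t 1 (@im R \o geodesic) (y' t).
Proof.
have D0 : D t != 0 by rewrite gt_eqF.
have -> : @im R \o geodesic = (fun t => b / D t) by [].
rewrite /D; derive_tac => //.
move: D0; rewrite /y' /D => D0 /=.
by field.
Qed.

Let cD (t : R) : continuous_at t D.
Proof. by rewrite /D; continuous_tac. Qed.

Lemma geodesic_C1 : C1_path geodesic.
Proof.
split=> [t|t||]; [by case: (dre t)|by case: (dim t)| |].
- have -> : derive1 (@re R \o geodesic) = x'.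
    by apply/funext => t; exact: is_derive_derive1 (dre t).
  move=> t; have cDt := cD t; rewrite /x'; continuous_tac.
  by rewrite expf_neq0// gt_eqF.
- have -> : derive1 (@im R \o geodesic) = y'.
    by apply/funext => t; exact: is_derive_derive1 (dim t).
  move=> t; have cDt := cD t; rewrite /y'; continuous_tac.
  by rewrite expf_neq0// gt_eqF.
Qed.

(** The speed is constantly [d], because [A^2 + (sinh - B cosh)^2 = D^2]. *)
Lemma geodesic_length : hyp_length geodesic = d.
Proof.
rewrite /hyp_length -[RHS](_ : \int[lebesgue_measure]_(t in `[0, 1]) d = d).
  apply: eq_Rintegral => t _.
  rewrite (is_derive_derive1 _ _ _ (dre t)) (is_derive_derive1 _ _ _ (dim t)).
  have D0 : D t != 0 by rewrite gt_eqF.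
  have cs := cosh2Dsinh2 (d * t).
  have -> : x' t ^+ 2 + y' t ^+ 2 = (d * (b / D t)) ^+ 2 *
      ((A ^+ 2 + (sinh (d * t) - B * cosh (d * t)) ^+ 2) / D t ^+ 2).
    by rewrite /x' /y'; field.
  have -> : A ^+ 2 + (sinh (d * t) - B * cosh (d * t)) ^+ 2 = D t ^+ 2.
    by rewrite /D; ring: cs A2.
  rewrite divff ?expf_neq0// mulr1.
  rewrite sqrtr_sqr ger0_norm; last by rewrite mulr_ge0// ltW.
  by rewrite mulfK// gt_eqF.
rewrite Rintegral_cst//= lebesgue_measure_itv/= lte_fin ltr01.
by rewrite oppr0 adde0 mulr1.
Qed.

End geodesic.

Lemma half_plane_eq z w : re z = re w -> im z = im w -> z = w.
Proof.
case: z w => [[x y] z0] [[x' y'] w0]; rewrite /re /im /= => xx' yy'.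
by apply: eq_exist; rewrite xx' yy'.
Qed.

(** The condition [g 1 = w] reads [D 1 = im z / im w] together with an equation for the real part,
    so it prescribes [A sinh d] and [B sinh d]. By the formula for [cosh d] the two prescribed
    values have squares of sum [sinh d ^ 2]; dividing by [sinh d] gives a unit vector. *)
Lemma geodesic_exists z w : exists g : R -> half_plane R,
  [/\ C1_path g, g 0 = z, g 1 = w & hyp_length g = arcosh (cosh_dist z w)].
Proof.
have z0 := im_gt0 z; have w0 := im_gt0 w.
have iz0 : im z != 0 by rewrite gt_eqF.
have iw0 : im w != 0 by rewrite gt_eqF.
have d0 := arcosh_ge0 _ (cosh_dist_ge1 z w).
have chd := arcoshK _ (cosh_dist_ge1 z w).
set d := arcosh _ in d0 chd *.
have shd := cosh2Dsinh2 d.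
suff [A [B [AB Ad Bd]]] : exists A B : R, [/\ A ^+ 2 + B ^+ 2 = 1,
    A * sinh d = (re w - re z) / im w & B * sinh d = cosh d - im z / im w].
  exists (geodesic (re z) (im z) A B d z0 AB); split.
  - exact: geodesic_C1.
  - apply: half_plane_eq; rewrite /re /im /= mulr0 sinh0 cosh0; by field.
  - have D1 : cosh (d * 1) - B * sinh (d * 1) = im z / im w.
      by rewrite mulr1 Bd; ring.
    have Ad1 : A * sinh (d * 1) = (re w - re z) / im w by rewrite mulr1.
    by apply: half_plane_eq; rewrite /re /im /= D1 ?Ad1 -/(re z) -/(im z)
      -/(re w) -/(im w); field; rewrite iz0 iw0.
  - exact: geodesic_length.
have id : ((re w - re z) / im w) ^+ 2 + (cosh d - im z / im w) ^+ 2 =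
    sinh d ^+ 2.
  have -> : sinh d ^+ 2 = cosh d ^+ 2 - 1 by rewrite shd; ring.
  by rewrite chd /cosh_dist; field; rewrite iz0 iw0.
(* If [sinh d = 0], both prescribed values vanish and any unit vector will do. *)
have [s0|s0] := eqVneq (sinh d) 0.
  exists 1, 0; split; rewrite ?s0.
  - by rewrite expr1n expr0n addr0.
  - move: id; rewrite s0 expr0n /= => /eqP; rewrite paddr_eq0 ?sqr_ge0//.
    by rewrite !sqrf_eq0 => /andP[/eqP -> _]; rewrite mulr0.
  - move: id; rewrite s0 expr0n /= => /eqP; rewrite paddr_eq0 ?sqr_ge0//.
    by rewrite !sqrf_eq0 => /andP[_ /eqP ->]; rewrite mulr0.
exists ((re w - re z) / im w / sinh d), ((cosh d - im z / im w) / sinh d).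
split; [|by rewrite divfK|by rewrite divfK].
rewrite [in LHS]expr_div_n [X in _ + X]expr_div_n -mulrDl id divff//.
by rewrite expf_neq0.
Qed.

Lemma hyp_distE z w : hyp_dist z w = arcosh (cosh_dist z w).
Proof.
rewrite /hyp_dist; set S := (X in inf X).
have [g [gC1 g0 g1 gl]] := geodesic_exists z w.
have lbS : lbound S (arcosh (cosh_dist z w)).
  by move=> _ [h [hC1 <- <-] <-]; exact: hyp_length_ge.
have Sg : S (arcosh (cosh_dist z w)) by exists g.
apply/eqP; rewrite eq_le; apply/andP; split.
  by apply: ge_inf => //; exists (arcosh (cosh_dist z w)).
by apply: lb_le_inf => //; exists (arcosh (cosh_dist z w)).
Qed.

End hyperbolic_distance.

(** * Orbits of the modular group *)

Section modular_group.
Context {R : realType}.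
Implicit Types (z w : half_plane R) (a b c d : int).

(** [|a z + b|^2] for [z] with coordinates [p]. Working on coordinates makes it a function on
    [R * R], where measurability is checked. *)
Definition sqr_norm_lin (a b : int) (p : R * R) : R :=
  (a%:~R * p.1 + b%:~R) ^+ 2 + a%:~R ^+ 2 * p.2 ^+ 2.

(** The Moebius action for determinant 1, with the denominator [|c z + d|^2] cleared and real and
    imaginary parts separated. *)
Definition is_image a b c d z w :=
  im w * sqr_norm_lin c d (re z, im z) = im z /\
  re w * sqr_norm_lin c d (re z, im z) =
    (a%:~R * re z + b%:~R) * (c%:~R * re z + d%:~R)
    + a%:~R * c%:~R * im z ^+ 2.

Lemma det2_neq0 a b c d : a * d - b * c = 1 -> (c != 0) || (d != 0).
Proof.
have [-> /=|//] := eqVneq c 0; have [->|//] := eqVneq d 0.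
by rewrite !mulr0 subrr => /eqP; rewrite eq_sym oner_eq0.
Qed.

Lemma sqr_norm_lin_gt0 c d z : (c != 0) || (d != 0) ->
  0 < sqr_norm_lin c d (re z, im z).
Proof.
move=> cd; have z0 := im_gt0 z; rewrite /sqr_norm_lin /=.
have [c0|c0] := eqVneq c 0.
  move: cd; rewrite c0 eqxx /= => d0.
  by rewrite mul0r add0r expr0n /= mul0r addr0 exprn_even_gt0 //= intr_eq0.
apply: ltr_wpDl; first exact: sqr_ge0.
by rewrite mulr_gt0 ?exprn_even_gt0 //= ?intr_eq0// gt_eqF.
Qed.

Lemma complex_ext (s t : R[i]) : complex.Re s = complex.Re t ->
  complex.Im s = complex.Im t -> s = t.
Proof. by case: s t => [x y] [x' y'] /= -> ->. Qed.

Lemma complex_affine (a b : int) (s : R[i]) : a%:~R * s + b%:~R =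
  Complex (a%:~R * complex.Re s + b%:~R) (a%:~R * complex.Im s).
Proof.
rewrite -!(rmorph_int (@real_complex R)); case: s => x y.
by apply: complex_ext => /=; rewrite ?mul0r ?subr0 ?addr0.
Qed.

Lemma det_mx22 (M : 'M[int]_2) : \det M = M 0 0 * M 1 1 - M 0 1 * M 1 0.
Proof.
rewrite (expand_det_row _ 0) !big_ord_recl big_ord0 /cofactor !det_mx11 !mxE /=.
rewrite expr0 mul1r addr0 expr1 mulN1r mulrN.
by congr (M _ _ * M _ _ - M _ _ * M _ _); apply/val_inj.
Qed.

Lemma moebius_image a b c d z w : a * d - b * c = 1 ->
  sval w = (a%:~R * sval z + b%:~R) / (c%:~R * sval z + d%:~R) <->
  is_image a b c d z w.
Proof.
move=> det1; have cd := det2_neq0 _ _ _ _ det1.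
have N0 := sqr_norm_lin_gt0 _ _ z cd.
have {}det1 : a%:~R * d%:~R - b%:~R * c%:~R = 1 :> R.
  by rewrite -!intrM -intrB det1.
rewrite !complex_affine -/(re z) -/(im z).
set C := Complex (c%:~R * _ + _) _; set A := Complex (a%:~R * _ + _) _.
have C0 : C != 0.
  apply/eqP => -[e1 e2]; move: N0.
  by rewrite /sqr_norm_lin /= -exprMn e1 e2 expr0n addr0 ltxx.
have -> : (sval w = A / C) <-> (sval w * C = A).
  by split=> [->|<-]; [rewrite divfK|rewrite mulfK].
have E : sval w * C = Complex
  (re w * (c%:~R * re z + d%:~R) - im w * (c%:~R * im z))
  (re w * (c%:~R * im z) + im w * (c%:~R * re z + d%:~R)).
  by rewrite /re /im /C; case: (sval w).
rewrite E /A /is_image /sqr_norm_lin /=; move: N0; rewrite /sqr_norm_lin /= =>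
  N0.
have {}N0 := lt0r_neq0 N0.
move: (re w) (im w) (re z) (im z) N0 det1 => u v x y.
move: (a%:~R : R) (b%:~R : R) (c%:~R : R) (d%:~R : R) => a' b' c' d' N0 det1.
have bc : b' * c' = a' * d' - 1 by rewrite -det1; ring.
split=> [[e1 e2]|[e1 e2]].
  split.
    (* Imaginary part, then real part, of [w C] times the conjugate of [C], where [C = c z + d]. *)
    transitivity ((u * (c' * y) + v * (c' * x + d')) * (c' * x + d') -
        (u * (c' * x + d') - v * (c' * y)) * (c' * y)); first by ring.
    by rewrite e1 e2; ring: bc.
  transitivity ((u * (c' * x + d') - v * (c' * y)) * (c' * x + d') +
      (u * (c' * y) + v * (c' * x + d')) * (c' * y)); first by ring.
  by rewrite e1 e2; ring.
set N := (X in X != 0) in N0 e1 e2.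
congr Complex; apply: (mulIf N0).
  transitivity (u * N * (c' * x + d') - v * N * (c' * y)); first by ring.
  by rewrite e1 e2 /N; ring: bc.
transitivity (u * N * (c' * y) + v * N * (c' * x + d')); first by ring.
by rewrite e1 e2 /N; ring: bc.
Qed.

(* [cosh (dist (M z) i) = frobenius M z / (2 im z)] for [M = [[a, b], [c, d]]]. *)
Definition frobenius (k : int * int * int * int) (p : R * R) : R :=
  let: (a, b, c, d) := k in sqr_norm_lin a b p + sqr_norm_lin c d p.

Definition unimodular (k : int * int * int * int) : bool :=
  let: (a, b, c, d) := k in a * d - b * c == 1.

(** The quadruple is the inverse of the second matrix times the first: moving both points by that
    inverse, an isometry, turns the distance from [w] to [v] into one to [i]. The proof is the
    corresponding polynomial identity. *)
Lemma cosh_dist_images a b c d a' b' c' d' z w v :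
  a * d - b * c = 1 -> a' * d' - b' * c' = 1 ->
  is_image a b c d z w -> is_image a' b' c' d' (half_plane_i R) v ->
  2 * im z * cosh_dist w v =
  frobenius (d' * a - b' * c, d' * b - b' * d,
             a' * c - c' * a, a' * d - c' * b) (re z, im z).
Proof.
move=> det1 det1' [iw rw] [iv rv].
have Nw := sqr_norm_lin_gt0 _ _ z (det2_neq0 _ _ _ _ det1).
have Nv := sqr_norm_lin_gt0 _ _ (half_plane_i R) (det2_neq0 _ _ _ _ det1').
have z0 := im_gt0 z; have w0 := im_gt0 w; have v0 := im_gt0 v.
have {}det1 : a%:~R * d%:~R - b%:~R * c%:~R = 1 :> R.
  by rewrite -!intrM -intrB det1.
have {}det1' : a'%:~R * d'%:~R - b'%:~R * c'%:~R = 1 :> R.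
  by rewrite -!intrM -intrB det1'.
move: iv rv Nv; rewrite /re /im /sqr_norm_lin /= -/(re v) -/(im v)
  -/(re z) -/(im z) -/(re w) -/(im w) => iv rv Nv.
move: iw rw Nw; rewrite /sqr_norm_lin /= => iw rw Nw.
rewrite /frobenius /sqr_norm_lin /= !intrB !intrM /cosh_dist.
move: (re w) (im w) (re v) (im v) (re z) (im z) z0 w0 v0 Nw iw rw iv rv.
move=> rw' iw' rv' iv' x y z0 w0 v0 Nw iw rw iv rv.
move: (a%:~R : R) (b%:~R : R) (c%:~R : R) (d%:~R : R) det1 iw rw Nw =>
  {}a {}b {}c {}d det1 iw rw Nw.
move: (a'%:~R : R) (b'%:~R : R) (c'%:~R : R) (d'%:~R : R) det1' iv rv Nv =>
  {}a' {}b' {}c' {}d' det1' iv rv Nv.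
have bc : b * c = a * d - 1 by rewrite -det1; ring.
have bc' : b' * c' = a' * d' - 1 by rewrite -det1'; ring.
set Mw := (X in 0 < X) in Nw iw rw; set Mv := (X in 0 < X) in Nv iv rv.
set F := (RHS).
suff : y * ((rw' - rv') ^+ 2 + iw' ^+ 2 + iv' ^+ 2) = F * (iw' * iv').
  move=> e; transitivity (y * ((rw' - rv') ^+ 2 + iw' ^+ 2 + iv' ^+ 2) /
    (iw' * iv')); first by field; rewrite !gt_eqF.
  by rewrite e mulfK// mulf_neq0 ?gt_eqF.
(* Multiplying by both squared denominators lets the equations of [is_image] eliminate the
   coordinates of [w] and [v]. *)
have MM : Mw ^+ 2 * Mv ^+ 2 != 0 by rewrite mulf_neq0 ?expf_neq0 ?gt_eqF.
apply: (mulIf MM).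
transitivity (y * ((rw' * Mw * Mv - rv' * Mv * Mw) ^+ 2 +
  (iw' * Mw) ^+ 2 * Mv ^+ 2 + (iv' * Mv) ^+ 2 * Mw ^+ 2)); first by ring.
transitivity (F * ((iw' * Mw) * (iv' * Mv)) * (Mw * Mv)); last by ring.
by rewrite iw iv rw rv /F /Mw /Mv; ring: bc bc'.
Qed.

Lemma unimodular_image a b c d z : a * d - b * c = 1 ->
  exists w, is_image a b c d z w.
Proof.
move=> det1; have N0 := sqr_norm_lin_gt0 _ _ z (det2_neq0 _ _ _ _ det1).
have w0 : 0 < im z / sqr_norm_lin c d (re z, im z).
  by rewrite divr_gt0// im_gt0.
exists (exist (fun s : R[i] => 0 < complex.Im s) (Complex
  (((a%:~R * re z + b%:~R) * (c%:~R * re z + d%:~R)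
    + a%:~R * c%:~R * im z ^+ 2) / sqr_norm_lin c d (re z, im z)) _) w0).
by split; rewrite divfK// gt_eqF.
Qed.

Lemma modular_orbitP z w : modular_orbit z w <->
  exists a b c d : int, a * d - b * c = 1 /\ is_image a b c d z w.
Proof.
split=> [[M]|[a [b [c [d [det1 img]]]]]].
  rewrite det_mx22 => det1 /moebius_image img.
  by exists (M 0 0), (M 0 1), (M 1 0), (M 1 1); split=> //; exact: img.
exists (\matrix_(i, j) if i == 0 then if j == 0 then a else b
                       else if j == 0 then c else d).
  by rewrite det_mx22 !mxE.
by rewrite !mxE /=; exact/moebius_image.
Qed.

(** The infimum is below [r] as soon as one pair of lifts is, and only the relative matrix of the
    pair matters. The condition [0 < r] is separate because [cosh r] does not see the sign of
    [r]. *)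
Lemma modular_dist_lt z (r : R) :
  modular_dist (modular_proj z) (@i_star R) < r <->
  0 < r /\ exists2 k, unimodular k &
    frobenius k (re z, im z) < 2 * im z * cosh r.
Proof.
have z0 := im_gt0 z.
have orbit_refl (v : half_plane R) : modular_orbit v v.
  apply/modular_orbitP; exists 1, 0, 0, 1; split; first by [].
  by rewrite /is_image /sqr_norm_lin /=; split; ring.
have dist_ge0 (v w : half_plane R) : 0 <= hyp_dist v w.
  by rewrite hyp_distE arcosh_ge0// cosh_dist_ge1.
have dist_lt (v w : half_plane R) s : 0 < s ->
  (hyp_dist v w < s) = (cosh_dist v w < cosh s).
  by move=> s0; rewrite hyp_distE arcosh_lt// cosh_dist_ge1.
rewrite /modular_dist /lifts /i_star /=; set S := (X in inf X).
have S_lb : has_lbound S by exists 0 => _ [v _ [w _ <-]].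
have S_ex : S !=set0.
  exists (hyp_dist z (half_plane_i R)), z; first exact: orbit_refl.
  by exists (half_plane_i R); first exact: orbit_refl.
split=> [Sr|[r0 [[[[a b] c] d] /eqP det1 lt_r]]].
  have [_ [v zv [w iw <-]] vw] := inf_lt S_ex Sr.
  have r0 := le_lt_trans (dist_ge0 v w) vw; split=> //.
  move: zv iw => /modular_orbitP[a [b [c [d [det1 zv]]]]].
  move=> /modular_orbitP[a' [b' [c' [d' [det1' iw]]]]].
  exists (d' * a - b' * c, d' * b - b' * d, a' * c - c' * a, a' * d - c' * b).
    rewrite /unimodular.
    have -> : (d' * a - b' * c) * (a' * d - c' * b) -
      (d' * b - b' * d) * (a' * c - c' * a) =
      (a * d - b * c) * (a' * d' - b' * c') by ring.
    by rewrite det1 det1'.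
  rewrite -(cosh_dist_images _ _ _ _ _ _ _ _ _ _ _ det1 det1' zv iw).
  by rewrite ltr_pM2l ?mulr_gt0// -dist_lt.
have [w zw] := unimodular_image _ _ _ _ z det1.
have ii : is_image 1 0 0 1 (half_plane_i R) (half_plane_i R).
  by rewrite /is_image /sqr_norm_lin /re /im /=; split; ring.
have det0 : 1 * 1 - 0 * 0 = 1 :> int by [].
have E := cosh_dist_images _ _ _ _ _ _ _ _ _ _ _ det1 det0 zw ii.
apply: (@le_lt_trans _ _ (hyp_dist w (half_plane_i R))).
  apply: ge_inf => //; exists w; last by exists (half_plane_i R).
  by apply/modular_orbitP; exists a, b, c, d.
rewrite dist_lt// -(@ltr_pM2l _ (2 * im z)) ?mulr_gt0// E.
by rewrite !mul1r !mul0r !subr0.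
Qed.

(** Four times the form is [(|a| - 2 |b|)^2 + 3 a^2], which is at least 3, and an integer that is at
    least 3/4 is at least 1. *)
Lemma norm_form_ge1 a b : a != 0 -> 1 <= a ^+ 2 - `|a * b| + b ^+ 2.
Proof.
move=> a0; rewrite normrM -(real_normK (num_real a)) -(real_normK (num_real b)).
have : 1 <= `|a| by lia.
move: `|a| `|b| => m n m1.
have : 0 <= (m - 2 * n) ^+ 2 := sqr_ge0 _.
by nia.
Qed.

Lemma fundamental_domain_norm z : fundamental_domain z ->
  1 <= re z ^+ 2 + im z ^+ 2.
Proof.
case=> z1 _ _; have : 1 <= Num.sqrt (re z ^+ 2 + im z ^+ 2).
  by rewrite -lecR -normc_def.
by move=> /(exprn_ege1 2); rewrite sqr_sqrtr// addr_ge0 ?sqr_ge0.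
Qed.

(** Since [|re z| <= 1/2], [|a z + b|^2 >= a^2 |z|^2 - |a b| + b^2]; since [|z| >= 1], replacing
    [(a^2 - 1) |z|^2] by [a^2 - 1] leaves [|z|^2] plus the form of [norm_form_ge1] minus 1. *)
Lemma sqr_norm_lin_ge (a b : int) z : fundamental_domain z ->
  (a != 0 -> re z ^+ 2 + im z ^+ 2 <= sqr_norm_lin a b (re z, im z)) /\
  ((a != 0) || (b != 0) -> 1 <= sqr_norm_lin a b (re z, im z)).
Proof.
move=> zF; have z1 := fundamental_domain_norm _ zF; case: zF => _ xl xr.
suff ge_norm : a != 0 -> re z ^+ 2 + im z ^+ 2 <= sqr_norm_lin a b (re z, im z).
  split=> //; have [a0 /= b0|a0 _] := eqVneq a 0; last first.
    exact: le_trans (ge_norm a0).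
  rewrite /sqr_norm_lin a0 /= mul0r add0r expr0n mul0r addr0 -rmorphXn ler1z.
  nia.
move=> a0; have := norm_form_ge1 a b a0.
rewrite -(ler_int R) intrD intrB intr_norm intrM !rmorphXn /= => ab1.
have : 1 <= a%:~R ^+ 2 :> R by rewrite -rmorphXn ler1z; nia.
rewrite /sqr_norm_lin /=; move: (a%:~R : R) (b%:~R : R) ab1 => A B ab1 A1.
have : - `|A * B| <= 2 * (A * B) * re z.
  have := ler_norm (A * B); have := ler_norm (- (A * B)); rewrite normrN.
  by nra.
by nra.
Qed.

(** Determinant 1 gives one row with a nonzero first entry, which contributes at least [|z|^2], and
    a nonzero other row, which contributes at least 1. *)
Lemma frobenius_min k z : fundamental_domain z -> unimodular k ->
  re z ^+ 2 + im z ^+ 2 + 1 <= frobenius k (re z, im z).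
Proof.
case: k => [[[a b] c] d] zF /eqP det1; rewrite /frobenius.
have [abz ab1] := sqr_norm_lin_ge a b z zF.
have [cdz cd1] := sqr_norm_lin_ge c d z zF.
have cd0 := det2_neq0 _ _ _ _ det1.
have [a0|a0] := eqVneq a 0; last by rewrite lerD ?abz ?cd1.
have b0 : b != 0 by apply: contra_eq_neq det1 => ->; rewrite a0; lia.
have c0 : c != 0 by apply: contra_eq_neq det1 => ->; rewrite a0; lia.
by rewrite addrC lerD ?cdz ?ab1// b0 orbT.
Qed.

Lemma modular_dist_lt_domain z (r : R) : fundamental_domain z ->
  modular_dist (modular_proj z) (@i_star R) < r <->
  0 < r /\ re z ^+ 2 + im z ^+ 2 + 1 < 2 * im z * cosh r.
Proof.
move=> zF; rewrite modular_dist_lt; split=> -[r0].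
  move=> [k kU lt_r]; split=> //; apply: le_lt_trans lt_r.
  exact: frobenius_min.
move=> lt_r; split=> //; exists (1, 0, 0, 1) => //.
rewrite /frobenius /sqr_norm_lin /=; apply: le_lt_trans lt_r.
by rewrite le_eqVlt; apply/orP; left; apply/eqP; ring.
Qed.

Lemma modular_projP (p : modular_surface R) : exists z, p = modular_proj z.
Proof.
by case: p => O Op; case: (Op) => z Oz; exists z; exact: eq_exist.
Qed.

Lemma modular_dist_ge0 (p : modular_surface R) : 0 <= modular_dist p (@i_star
  R).
Proof.
have [z ->] := modular_projP p; rewrite leNgt; apply/negP.
by move=> /(modular_dist_lt z 0) []; rewrite ltxx.
Qed.

Lemma measurable_sqr_norm_lin (a b : int) :
  measurable_fun [set: measurableTypeR R * measurableTypeR R]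
    (sqr_norm_lin a b).
Proof.
rewrite /sqr_norm_lin; apply: measurable_funD.
  apply: measurable_funX; apply: measurable_funD => //.
  by apply: measurable_funM => //; exact: measurable_fst.
by apply: measurable_funM => //; apply: measurable_funX; exact: measurable_snd.
Qed.

Lemma measurable_frobenius (c : R) k :
  measurable [set p : measurableTypeR R * measurableTypeR R |
    frobenius k p < 2 * p.2 * c].
Proof.
case: k => [[[a b] a'] b'].
rewrite -[X in measurable X]setTI.
apply: (@measurable_fun_ltr _ _ _ setT (frobenius (a, b, a', b'))
  (fun p => 2 * p.2 * c) _ _ measurableT [set true]) => //.
  by apply: measurable_funD; exact: measurable_sqr_norm_lin.
by apply: measurable_funM => //; apply: measurable_funM => //;
  exact: measurable_snd.
Qed.

(** The lifts of the ball are cut out by a union of polynomial inequalities over the unimodular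
    quadruples, enumerated by [unpickle]; codes of no quadruple contribute [set0]. *)
Lemma measurable_modular_dist_lt (r : R) :
  measurable [set p : modular_surface R | modular_dist p (@i_star R) < r].
Proof.
have [r0|r0] := leP r 0.
  rewrite (_ : mkset _ = set0); first exact: measurable0.
  apply/seteqP; split=> p //= pr.
  by have := lt_le_trans pr r0; rewrite ltNge modular_dist_ge0.
pose F k : set (measurableTypeR R * measurableTypeR R) :=
  if unimodular k then [set p | frobenius k p < 2 * p.2 * cosh r] else set0.
have mF k : measurable (F k).
  by rewrite /F; case: ifP => _; [exact: measurable_frobenius|exact:
    measurable0].
have mB : measurable (\bigcup_n oapp F set0 (unpickle n)).
  apply: bigcupT_measurable => n; case: unpickle => [k|]; first exact: mF.
  exact: measurable0.
rewrite /measurable /= /modular_measurable /=.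
exists (\bigcup_n oapp F set0 (unpickle n)); first exact: mB.
rewrite setTI; apply/seteqP; split=> z.
  move=> [n _]; case: unpickle => // k; rewrite /= /F.
  case: ifP => // kU lt_r; apply/modular_dist_lt; split=> //; by exists k.
move=> /modular_dist_lt [_ [k kU lt_r]].
have Fk : F k (coords z) by rewrite /F kU.
exists (pickle k); first by [].
by rewrite pickleK; exact: Fk.
Qed.

End modular_group.

(** * Integrals and arctangents *)

Section integrals_on_segments.
Context {R : realType}.
Implicit Types (f F : R -> R) (a b c : R).

Lemma integral_segment_split f a b c : measurable_fun setT f ->
  a <= b -> b <= c ->
  (\int[lebesgue_measure]_(x in `[a, c]) (f x)%:E =
   \int[lebesgue_measure]_(x in `[a, b]) (f x)%:E +
   \int[lebesgue_measure]_(x in `[b, c]) (f x)%:E)%E.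
Proof.
move=> mf ab bc.
have mfD D : measurable_fun D f by exact: measurable_funTS.
rewrite (@itv_bndbnd_setU _ _ _ (BLeft b)) ?bnd_simp//.
rewrite integral_setU_EFin//.
- by rewrite integral_itv_bndo_bndc//; exact/measurable_EFinP.
- exact: mfD.
- rewrite disj_set2E; apply/eqP/seteqP; split=> x //=.
  rewrite !in_itv/= => -[/andP[_ xb] /andP[bx _]].
  by move: xb; rewrite ltNge bx.
Qed.

(** Derivatives are asked for in the open interval only, because the square roots in the primitives
    used later may vanish at an end. Degenerate segments are allowed, so that thresholds need no
    separate case. *)
Lemma FTC_segment f F a b : a <= b ->
  {in `[a, b], forall x, continuous_at x f} ->
  {in `[a, b], forall x, continuous_at x F} ->
  {in `]a, b[, forall x : R, is_derive x 1 F (f x)} ->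
  (\int[lebesgue_measure]_(x in `[a, b]) (f x)%:E = (F b - F a)%:E)%E.
Proof.
rewrite le_eqVlt => /predU1P[<- _ _ _|ab cf cF dF].
  by rewrite set_itv1 integral_set1 subrr.
have Fa : continuous_at a F by apply: cF; rewrite in_itv/= lexx ltW.
have Fb : continuous_at b F by apply: cF; rewrite in_itv/= lexx ltW.
rewrite EFinB; apply: continuous_FTC2 => //.
- by apply: continuous_in_subspaceT => x /set_mem/= /cf.
- split; first by move=> x /dF [].
  + exact: cvg_at_right_filter.
  + exact: cvg_at_left_filter.
- by move=> x /dF dx; exact: is_derive_derive1 dx.
Qed.

End integrals_on_segments.

(** * Arctangent identities within the principal branch *)

Section arctangent.
Context {R : realType}.
Implicit Types x y : R.

Lemma atan_ge0 x : 0 <= x -> 0 <= atan x.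
Proof. by move=> /le_atan; rewrite atan0. Qed.

Lemma tan_atanD x y : x * y != 1 ->
  tan (atan x + atan y) = (x + y) / (1 - x * y).
Proof.
have cos0 z : cos (@atan R z) != 0.
  by rewrite gt_eqF// cos_gt0_pihalf// atan_gtNpi2 atan_ltpi2.
by move=> xy; rewrite tanD ?atanK.
Qed.

(** Two angles in [[0, pi/2)] have their difference in the principal branch. *)
Lemma atanB x y : 0 <= x -> 0 <= y ->
  atan x - atan y = atan ((x - y) / (1 + x * y)).
Proof.
move=> x0 y0; have xy0 : 0 <= x * y by exact: mulr_ge0.
rewrite -atanN -(tanK (x := atan x + atan (- y))).
  by rewrite tan_atanD ?mulrN ?opprK// lt_eqF//; lra.
have := atan_ge0 x x0; have := atan_ge0 y y0.
have := atan_ltpi2 x; have := atan_ltpi2 y.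
by rewrite in_itv/= atanN => ? ? ? ?; apply/andP; split; lra.
Qed.

(** The bound [x < 1] keeps the doubled angle below [pi/2]. *)
Lemma atan_double x : 0 <= x -> x < 1 ->
  2 * atan x = atan (2 * x / (1 - x ^+ 2)).
Proof.
move=> x0 x1; have x4 : atan x < pi / 4 by rewrite -atan1 lt_atan.
have := atan_ge0 x x0; have -> : 2 * atan x = atan x + atan x by ring.
move=> ax0; rewrite -(tanK (x := atan x + atan x)).
  rewrite tan_atanD; first by congr (atan (_ / _)); ring.
  by rewrite lt_eqF//; nra.
have := pi_gt0 R.
by rewrite in_itv/= => ?; apply/andP; split; lra.
Qed.

Lemma atan_inv x : 0 < x -> atan x^-1 = pi / 2 - atan x.
Proof.
move=> x0; have := atan_gtNpi2 x; have := atan_ltpi2 x.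
have := atan_ge0 x (ltW x0) => ax0 ? ?.
have ax : 0 < atan x by rewrite -atan0 lt_atan.
rewrite -(tanK (x := pi / 2 - atan x)); last first.
  by rewrite in_itv/=; apply/andP; split; lra.
congr atan; rewrite /tan sinB cosB sin_pihalf cos_pihalf.
rewrite !mul1r !mul0r subr0 add0r -invf_div -/(tan _) atanK//.
Qed.

(** From [cos^2 a = 3/4] the triple-angle formula gives [cos (3 a) = 0], and [a < pi/4] leaves only
    [3 a = pi/2]. *)
Lemma atan_inv_sqrt3 : atan (Num.sqrt 3)^-1 = pi / 6 :> R.
Proof.
have s3 : (Num.sqrt 3 : R) ^+ 2 = 3 by rewrite sqr_sqrtr.
have s0 : 0 < Num.sqrt 3 :> R by rewrite sqrtr_gt0.
set a := atan _.
have a0 : 0 <= a by rewrite atan_ge0// invr_ge0 ltW.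
have a4 : a < pi / 4.
  by rewrite -atan1 lt_atan// invf_lt1// -[ltLHS]sqrtr1 ltr_sqrt//; lra.
have c2 : cos a ^+ 2 = 3 / 4.
  rewrite /a cos_atan exprVn sqr_sqrtr ?addr_ge0 ?sqr_ge0// exprVn s3.
  by field.
have c3 : cos (a + (a + a)) = 0.
  have s2 : sin a ^+ 2 = 1 / 4.
    by have := cos2Dsin2 a; rewrite c2; lra.
  rewrite !cosD !sinD; transitivity (cos a * (cos a ^+ 2 - 3 * sin a ^+ 2)).
    by ring.
  by rewrite c2 s2; field.
have p0 := pi_gt0 R.
suff : a + (a + a) = pi / 2 by lra.
apply: cos_inj; rewrite ?in_itv/= ?c3 ?cos_pihalf//; apply/andP; split; lra.
Qed.

End arctangent.

(** * The density *)

Section density.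
Context {R : realType}.
Implicit Types r x y : R.

(* For [sinh r < 1/2] the argument is negative and the square root is 0. *)
Definition width r : R := Num.sqrt (4 * sinh r ^+ 2 - 1).

(** Half the angle, seen from [i], of the arc of the hyperbolic circle of radius [r] that lies
    beyond the line [Re z = 1/2]; the arc is symmetric about the perpendicular from [i] to that
    line. *)
Definition angle r : R := atan (width r / cosh r).

(** The angle at [i] between that perpendicular and the unit circle. The lower half of the arc
    beyond the line counts only as far as the unit circle. *)
Definition angle_max : R := atan (1 / 2).

(** [3 / pi] times the length of the hyperbolic circle inside the fundamental domain: the unit
    circle is a geodesic through [i] and leaves the half circle [pi sinh r], from which an arc is
    removed at each side. *)
Definition density r : R :=
  sinh r * (3 - 6 / pi * (angle r + Num.min (angle r) angle_max)).

(* Antiderivative of [sinh r * angle r]. *)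
Definition cap r : R := cosh r * angle r - atan (width r).

Lemma width_ge0 r : 0 <= width r. Proof. exact: sqrtr_ge0. Qed.

Lemma sqr_width r : 1 <= 4 * sinh r ^+ 2 -> width r ^+ 2 = 4 * sinh r ^+ 2 - 1.
Proof. by move=> h; rewrite sqr_sqrtr// subr_ge0. Qed.

Lemma width_eq0 r : 4 * sinh r ^+ 2 <= 1 -> width r = 0.
Proof. by move=> h; apply/eqP; rewrite sqrtr_eq0 subr_le0. Qed.

Lemma width_gt0 r : 1 < 4 * sinh r ^+ 2 -> 0 < width r.
Proof. by move=> h; rewrite sqrtr_gt0 subr_gt0. Qed.

Lemma angle_ge0 r : 0 <= angle r.
Proof. by rewrite atan_ge0// divr_ge0 ?width_ge0// ltW// cosh_gt0. Qed.

Lemma width_ltcosh r : width r < 2 * cosh r.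
Proof.
have c0 := cosh_gt0 r; have cs := cosh2Dsinh2 r.
have [s1|/ltW s1] := leP (4 * sinh r ^+ 2) 1; first by rewrite width_eq0//; lra.
rewrite -(@ltr_pXn2r _ 2) ?nnegrE ?width_ge0 ?mulr_ge0 ?(ltW c0)//.
by rewrite sqr_width// [ltRHS]exprMn cs; lra.
Qed.

(** Squared, the comparison is [4 (4 s^2 - 1) <= 1 + s^2] with [s = sinh r], which is
    [3 s^2 <= 1]. *)
Lemma angle_le r : 3 * sinh r ^+ 2 <= 1 -> angle r <= angle_max.
Proof.
move=> s3; have c0 := cosh_gt0 r; have cs := cosh2Dsinh2 r.
rewrite le_atan// ler_pdivrMr//.
have [s1|/ltW s1] := leP (4 * sinh r ^+ 2) 1; first by rewrite width_eq0//; lra.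
rewrite -(@ler_pXn2r _ 2) ?nnegrE ?width_ge0 ?mulr_ge0 ?(ltW c0)//.
by rewrite sqr_width// [leRHS]exprMn cs; lra.
Qed.

Lemma angle_ge r : 1 <= 3 * sinh r ^+ 2 -> angle_max <= angle r.
Proof.
move=> s3; have c0 := cosh_gt0 r; have cs := cosh2Dsinh2 r.
rewrite le_atan// ler_pdivlMr//.
rewrite -(@ler_pXn2r _ 2) ?nnegrE ?width_ge0 ?mulr_ge0 ?(ltW c0)//.
by rewrite sqr_width ?[leLHS]exprMn ?cs; lra.
Qed.

Lemma angle_eq0 r : 4 * sinh r ^+ 2 <= 1 -> angle r = 0.
Proof. by move=> h; rewrite /angle width_eq0// mul0r atan0. Qed.

Lemma cap_eq0 r : 4 * sinh r ^+ 2 <= 1 -> cap r = 0.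
Proof. by move=> h; rewrite /cap angle_eq0// width_eq0// atan0 mulr0 subr0. Qed.

Lemma density_near r : 4 * sinh r ^+ 2 <= 1 -> density r = 3 * sinh r.
Proof. by move=> h; rewrite /density angle_eq0// min_l ?atan_ge0//; ring. Qed.

Lemma density_middle r : 3 * sinh r ^+ 2 <= 1 ->
  density r = sinh r * (3 - 6 / pi * (2 * angle r)).
Proof. by move=> h; rewrite /density min_l ?angle_le//; ring. Qed.

Lemma density_far r : 1 <= 3 * sinh r ^+ 2 ->
  density r = sinh r * (3 - 6 / pi * (angle r + angle_max)).
Proof. by move=> h; rewrite /density min_r ?angle_ge. Qed.

Lemma angle_maxE : angle_max = pi / 2 - atan 2.
Proof. by rewrite -atan_inv// /angle_max mul1r. Qed.

Lemma angle_lt_atan2 r : angle r < atan 2.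
Proof. by rewrite lt_atan// ltr_pdivrMr ?cosh_gt0// width_ltcosh. Qed.

(** Here [atan 2 = pi/2 - angle_max] is also the limit of [angle], so this form exhibits the decay
    of the angular factor. *)
Lemma density_tail r : 1 <= 3 * sinh r ^+ 2 ->
  density r = 6 / pi * sinh r * (atan 2 - angle r).
Proof.
move=> h; have := lt0r_neq0 (pi_gt0 R); rewrite density_far// angle_maxE.
by move: (@pi R) => p p0; field.
Qed.

(** The two removed angles add up to less than [atan 2 + atan (1/2) = pi/2]. *)
Lemma density_ge0 r : 0 <= r -> 0 <= density r.
Proof.
move=> r0; rewrite mulr_ge0 ?sinh_ge0//.
have p0 := pi_gt0 R; have := angle_lt_atan2 r.
have : Num.min (angle r) angle_max <= angle_max by rewrite ge_min lexx orbT.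
rewrite angle_maxE; set m := Num.min _ _ => m1 a2.
rewrite subr_ge0 mulrAC ler_pdivrMr//; lra.
Qed.

Lemma continuous_width r : continuous_at r width.
Proof.
by rewrite /width; have c := @continuous_sinh R r; continuous_tac.
Qed.

Lemma continuous_angle r : continuous_at r angle.
Proof.
rewrite /angle; have c := continuous_width r; continuous_tac.
by rewrite gt_eqF// cosh_gt0.
Qed.

Lemma continuous_cap r : continuous_at r cap.
Proof.
have w := continuous_width r; have a := continuous_angle r.
by rewrite /cap; continuous_tac.
Qed.

Lemma continuous_density r : continuous_at r density.
Proof.
have a := continuous_angle r; rewrite /density.
have m : continuous_at r (fun t => Num.min (angle t) angle_max).
  by apply: continuous_min => //; exact: continuous_rule_cst.
by continuous_tac.
Qed.

Lemma is_derive_angle r : 1 < 4 * sinh r ^+ 2 -> sinh r != 0 ->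
  is_derive r 1 angle (sinh r * width r)^-1.
Proof.
move=> s1 s0; have w0 := width_gt0 r s1; have c0 := cosh_gt0 r.
have cs := cosh2Dsinh2 r; have w2 := sqr_width r (ltW s1).
rewrite /angle /width; derive_tac.
- by rewrite subr_gt0.
- by rewrite gt_eqF.
rewrite -/(width r); move: (width r) (cosh r) (sinh r) w0 c0 s0 cs w2 => w c s.
move=> w0 c0 s0 cs w2 /=.
have cw : c ^+ 2 + w ^+ 2 = 5 * s ^+ 2 by rewrite cs w2; ring.
have -> : 1 + (w / c) ^+ 2 = 5 * s ^+ 2 / c ^+ 2.
  by rewrite -cw; field; rewrite gt_eqF.
field: cs w2; rewrite s0 !gt_eqF//.
Qed.

Lemma is_derive_cap r : 1 < 4 * sinh r ^+ 2 -> sinh r != 0 ->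
  is_derive r 1 cap (sinh r * angle r).
Proof.
move=> s1 s0; have w0 := width_gt0 r s1; have c0 := cosh_gt0 r.
have cs := cosh2Dsinh2 r; have w2 := sqr_width r (ltW s1).
have da := is_derive_angle r s1 s0; rewrite /cap.
have dw : is_derive r 1 width (4 * sinh r * cosh r / width r).
  rewrite {1}/width; derive_tac; first by rewrite subr_gt0.
  by rewrite -/(width r) /=; field; rewrite gt_eqF.
derive_tac; rewrite w2 (_ : 1 + _ = 4 * sinh r ^+ 2); last by ring.
by field; rewrite s0 gt_eqF.
Qed.

Lemma arsinh_le r x : (arsinh x <= r) = (x <= sinh r).
Proof. by rewrite -le_sinh arsinhK. Qed.

Lemma le_arsinh r x : (r <= arsinh x) = (sinh r <= x).
Proof. by rewrite -le_sinh arsinhK. Qed.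

Lemma sqr_sinh_half r : 0 <= r ->
  (4 * sinh r ^+ 2 <= 1) = (r <= arsinh (1 / 2)).
Proof.
move=> /sinh_ge0 s0; rewrite le_arsinh.
rewrite -[in RHS](@ler_pXn2r _ 2) ?nnegrE// (_ : (1 / 2) ^+ 2 = 1 / 4);
  last by field.
by apply/idP/idP => h; lra.
Qed.

Lemma half_sqr_sinh r : 0 <= r ->
  (1 <= 4 * sinh r ^+ 2) = (arsinh (1 / 2) <= r).
Proof.
move=> /sinh_ge0 s0; rewrite arsinh_le.
rewrite -[in RHS](@ler_pXn2r _ 2) ?nnegrE// (_ : (1 / 2) ^+ 2 = 1 / 4);
  last by field.
by apply/idP/idP => h; lra.
Qed.

Lemma sqr_inv_sqrt3 : (1 / Num.sqrt 3) ^+ 2 = 1 / 3 :> R.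
Proof. by rewrite expr_div_n sqr_sqrtr// expr1n. Qed.

Lemma sqr_sinh_third r : 0 <= r ->
  (3 * sinh r ^+ 2 <= 1) = (r <= arsinh (1 / Num.sqrt 3)).
Proof.
have i0 : 0 <= 1 / Num.sqrt 3 :> R by rewrite divr_ge0 ?sqrtr_ge0.
move=> /sinh_ge0 s0; rewrite le_arsinh.
rewrite -[in RHS](@ler_pXn2r _ 2) ?nnegrE//.
rewrite sqr_inv_sqrt3.
by apply/idP/idP => h; lra.
Qed.

Lemma third_sqr_sinh r : 0 <= r ->
  (1 <= 3 * sinh r ^+ 2) = (arsinh (1 / Num.sqrt 3) <= r).
Proof.
have i0 : 0 <= 1 / Num.sqrt 3 :> R by rewrite divr_ge0 ?sqrtr_ge0.
move=> /sinh_ge0 s0; rewrite arsinh_le.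
rewrite -[in RHS](@ler_pXn2r _ 2) ?nnegrE//.
rewrite sqr_inv_sqrt3.
by apply/idP/idP => h; lra.
Qed.

Lemma arsinh_ge0 x : 0 <= x -> 0 <= arsinh x.
Proof. by rewrite -[0 <= arsinh x]le_sinh sinh0 arsinhK. Qed.

End density.

(** * The density as a single arctangent *)

Section density_formulas.
Context {R : realType}.
Implicit Types r x y : R.

Lemma widthE r : Num.sqrt (2 * cosh (2 * r) - 3) = width r.
Proof. by rewrite /width cosh_double; congr Num.sqrt; ring. Qed.

(** Doubling of [w / c], which is below 1 as [w^2 = 4 s^2 - 1 < 1 + s^2 = c^2]. The stated
    denominator is [4 - 6 s^2], positive on this range. *)
Lemma density_middle_atan r : 1 <= 4 * sinh r ^+ 2 -> 3 * sinh r ^+ 2 <= 1 ->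
  density r = sinh r * (3 - 6 / pi *
    atan (4 * cosh r * Num.sqrt (2 * cosh (2 * r) - 3) /
          (7 - 3 * cosh (2 * r)))).
Proof.
move=> s4 s3; rewrite density_middle// widthE /angle cosh_double.
have := sqr_width r s4; have := cosh_gt0 r; have := width_ge0 r.
have := cosh2Dsinh2 r; move: s3.
move: (width r) (cosh r) (sinh r) => w c s s3 c2 w0 c0 w2.
have wc : w < c.
  by rewrite -(@ltr_pXn2r _ 2) ?nnegrE ?(ltW c0)// c2 w2; lra.
rewrite atan_double ?divr_ge0 ?(ltW c0) ?ltr_pdivrMr ?mul1r//.
congr (_ * (_ - _ * atan _)).
have d0 : 4 - 6 * s ^+ 2 != 0 by rewrite gt_eqF//; lra.
have -> : 7 - 3 * (2 * s ^+ 2 + 1) = 4 - 6 * s ^+ 2 by ring.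
have -> : 1 - (w / c) ^+ 2 = (4 - 6 * s ^+ 2) / (2 * c ^+ 2).
  rewrite expr_div_n w2; field: c2; by rewrite gt_eqF.
by field; rewrite ?d0 ?(gt_eqF c0).
Qed.

(** [2 (atan 2 - angle r)] becomes one arctangent by subtraction, then doubling of
    [(2 c - w) / (c + 2 w)]; this ratio lies between 0 and 1 since [w < 2 c] and [c < 3 w]. The
    stated fraction is the same number with numerator and denominator both negative. *)
Lemma density_far_atan r : 0 <= r -> 1 <= 3 * sinh r ^+ 2 ->
  density r = 3 / pi * sinh r *
    atan (4 * (1 - cosh (2 * r) -
               cosh r * Num.sqrt (2 * cosh (2 * r) - 3)) /
          (5 * cosh (2 * r) - 2 * cosh (4 * r) -
           8 * sinh r ^+ 2 * cosh r * Num.sqrt (2 * cosh (2 * r) - 3) + 1)).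
Proof.
move=> r0 s3; rewrite density_tail// widthE /angle.
have cosh4 : cosh (4 * r) = 8 * sinh r ^+ 4 + 8 * sinh r ^+ 2 + 1.
  have -> : 4 * r = 2 * (2 * r) by ring.
  rewrite cosh_double; have := cosh2Dsinh2 (2 * r); rewrite cosh_double => e.
  have -> : sinh (2 * r) ^+ 2 = (2 * sinh r ^+ 2 + 1) ^+ 2 - 1.
    by rewrite e; ring.
  by ring.
rewrite cosh4 cosh_double.
have := sqr_width r; have := cosh_gt0 r; have := width_ge0 r.
have := width_ltcosh r; have := cosh2Dsinh2 r; have := sinh_ge0 r r0; move: s3.
move: (width r) (cosh r) (sinh r) => w c s s3 s0 c2 w2c w0 c0 w2.
have {}w2 : w ^+ 2 = 4 * s ^+ 2 - 1 by apply: w2; lra.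
have w_gt0 : 0 < w.
  by rewrite -(@ltr_pXn2r _ 2) ?nnegrE// w2 expr0n /=; lra.
have c3w : c < 3 * w.
  by rewrite -(@ltr_pXn2r _ 2) ?nnegrE ?mulr_ge0 ?(ltW c0)// exprMn w2 c2; lra.
(* Makes the stated denominator [4 - 6 s^2 - 16 s^4 - 8 s^2 c w] negative; equality holds at
   [3 s^2 = 1]. *)
have cw_ge : 2 / 3 <= c * w.
  rewrite -(@ler_pXn2r _ 2) ?nnegrE ?mulr_ge0 ?(ltW c0)// [leRHS]exprMn w2 c2.
  have -> : (2 / 3) ^+ 2 = 4 / 9 :> R by field.
  nra.
have -> : 6 / pi * s * (atan 2 - atan (w / c)) =
    3 / pi * s * (2 * (atan 2 - atan (w / c))) by ring.
congr (_ * _).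
have twc : 0 < c + 2 * w by lra.
have c20 : c != 0 by rewrite gt_eqF.
rewrite atanB ?divr_ge0 ?(ltW c0)//.
have -> : (2 - w / c) / (1 + 2 * (w / c)) = (2 * c - w) / (c + 2 * w).
  field; rewrite c20 gt_eqF//; lra.
rewrite atan_double; last 2 first.
- by rewrite divr_ge0 ?(ltW twc)//; lra.
- by rewrite ltr_pdivrMr// mul1r; lra.
congr atan.
have D1 : (c + 2 * w) ^+ 2 - (2 * c - w) ^+ 2 != 0.
  by rewrite gt_eqF// subr_gt0 ltr_pXn2r ?nnegrE//; lra.
have -> : 2 * ((2 * c - w) / (c + 2 * w)) / (1 - ((2 * c - w) / (c + 2 * w))
  ^+ 2)
    = 2 * (2 * c - w) * (c + 2 * w) / ((c + 2 * w) ^+ 2 - (2 * c - w) ^+ 2).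
  by field; rewrite D1 gt_eqF.
apply/eqP; rewrite eqr_div//.
  by apply/eqP; ring: c2 w2.
by rewrite lt_eqF//; nra.
Qed.

End density_formulas.

(** * The distribution function obtained from the density *)

Section density_integral.
Context {R : realType}.
Implicit Types r a b : R.

Lemma sinh_itv a b r : 0 <= a -> r \in `]a, b[ ->
  0 <= sinh a /\ sinh a < sinh r < sinh b.
Proof.
by move=> a0; rewrite in_itv/= !lt_sinh => rab; split=> //; exact: sinh_ge0.
Qed.

Lemma integral_density_near r : 0 <= r -> 4 * sinh r ^+ 2 <= 1 ->
  (\int[lebesgue_measure]_(x in `[0%R, r]) (density x)%:E =
   (3 * cosh r - 3 * cosh 0)%:E)%E.
Proof.
move=> r0 s4; apply: (FTC_segment _ (fun x => 3 * cosh x) _ _ r0).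
- by move=> x _; exact: continuous_density.
- by move=> x _; continuous_tac.
- move=> x /(sinh_itv _ _ _ (lexx 0)) [_ /andP[]]; rewrite sinh0 => x0 xr.
  derive_tac; rewrite density_near; last by nra.
  by ring.
Qed.

Lemma integral_density_middle a b : 0 <= a -> a <= b ->
  1 <= 4 * sinh a ^+ 2 -> 3 * sinh b ^+ 2 <= 1 ->
  (\int[lebesgue_measure]_(x in `[a, b]) (density x)%:E =
   (3 * cosh b - 12 / pi * cap b - (3 * cosh a - 12 / pi * cap a))%:E)%E.
Proof.
move=> a0 ab s4 s3.
apply: (FTC_segment _ (fun x => 3 * cosh x - 12 / pi * cap x) _ _ ab).
- by move=> x _; exact: continuous_density.
- by move=> x _; have c := continuous_cap x; continuous_tac.
- move=> x /(sinh_itv _ _ _ a0) [sa0 /andP[ax xb]].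
  have dc : is_derive x 1 cap (sinh x * angle x).
    by apply: is_derive_cap; [nra|rewrite gt_eqF//; lra].
  derive_tac; rewrite density_middle; last by nra.
  by ring.
Qed.

Lemma integral_density_far a b : 0 <= a -> a <= b -> 1 <= 3 * sinh a ^+ 2 ->
  (\int[lebesgue_measure]_(x in `[a, b]) (density x)%:E =
   (3 * cosh b - 6 / pi * (cap b + cosh b * angle_max) -
    (3 * cosh a - 6 / pi * (cap a + cosh a * angle_max)))%:E)%E.
Proof.
move=> a0 ab s3.
apply: (FTC_segment _
  (fun x => 3 * cosh x - 6 / pi * (cap x + cosh x * angle_max)) _ _ ab).
- by move=> x _; exact: continuous_density.
- by move=> x _; have c := continuous_cap x; continuous_tac.
- move=> x /(sinh_itv _ _ _ a0) [sa0 /andP[ax xb]].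
  have dc : is_derive x 1 cap (sinh x * angle x).
    by apply: is_derive_cap; [nra|rewrite gt_eqF//; nra].
  derive_tac; rewrite density_far; last by nra.
  by ring.
Qed.

Lemma measurable_density : measurable_fun setT (@density R).
Proof.
by apply: continuous_measurable_fun => x; exact: continuous_density.
Qed.

(** As [cap] vanishes up to [arsinh (1/2)], the first two ranges share one formula. *)
Lemma integral_density_le_third r : 0 <= r -> 3 * sinh r ^+ 2 <= 1 ->
  (\int[lebesgue_measure]_(x in `[0%R, r]) (density x)%:E =
   (3 / pi * (pi * (cosh r - 1) - 4 * cap r))%:E)%E.
Proof.
move=> r0 s3; have p0 := lt0r_neq0 (pi_gt0 R).
have [s4|/ltW s4] := leP (4 * sinh r ^+ 2) 1.
  rewrite integral_density_near// cosh0 cap_eq0//; congr EFin.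
  by move: (@pi R) p0 => p p0; field.
set a : R := arsinh (1 / 2).
have a0 : 0 <= a by rewrite arsinh_ge0.
have sa : sinh a = 1 / 2 by rewrite arsinhK.
have ar : a <= r by rewrite -half_sqr_sinh.
rewrite (integral_segment_split _ _ _ _ measurable_density a0 ar).
have sa4 : 4 * sinh a ^+ 2 = 1 by rewrite sa; field.
rewrite integral_density_near ?sa4// integral_density_middle ?sa4//.
rewrite (cap_eq0 a) ?sa4// -EFinD cosh0; congr EFin.
by move: (@pi R) p0 => p p0; field.
Qed.

(** At the second threshold [width r = 1 / sqrt 3]; the resulting [pi / 6] is the origin of the
    constant [pi / 3] in the last range. *)
Lemma cap_third r : 0 <= r -> 3 * sinh r ^+ 2 = 1 ->
  cap r = cosh r * angle_max - pi / 6.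
Proof.
move=> r0 s3; have cs := cosh2Dsinh2 r.
have s2 : sinh r ^+ 2 = 1 / 3 by lra.
have w2 : width r = (Num.sqrt 3)^-1.
  rewrite /width s2 (_ : _ - _ = 3^-1) ?sqrtrV//; by field.
have i_gt0 : 0 < (Num.sqrt 3 : R)^-1 by rewrite invr_gt0 sqrtr_gt0.
have c2 : cosh r = 2 * (Num.sqrt 3)^-1.
  have i2 : 0 <= 2 * (Num.sqrt 3 : R)^-1 by rewrite mulr_ge0// ltW.
  apply/eqP; rewrite -(@eqrXn2 _ 2 _ _ _ (ltW (cosh_gt0 r)) i2)// cs s2.
  by rewrite exprMn exprVn sqr_sqrtr//; apply/eqP; field.
have i0 := lt0r_neq0 i_gt0.
rewrite /cap /angle /angle_max w2 atan_inv_sqrt3 c2; congr (_ * atan _ - _).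
by field; move: i0; rewrite invr_eq0.
Qed.

Lemma integral_density_ge_third r : 0 <= r -> 1 <= 3 * sinh r ^+ 2 ->
  (\int[lebesgue_measure]_(x in `[0%R, r]) (density x)%:E =
   (3 / pi * (pi * (cosh r - 1) - 2 * cap r - 2 * cosh r * angle_max + pi / 3))
     %:E)%E.
Proof.
move=> r0 s3; have p0 := lt0r_neq0 (pi_gt0 R).
set a : R := arsinh (1 / Num.sqrt 3).
have a0 : 0 <= a by rewrite arsinh_ge0// divr_ge0 ?sqrtr_ge0.
have ar : a <= r by rewrite -third_sqr_sinh.
have sa : 3 * sinh a ^+ 2 = 1 by rewrite arsinhK sqr_inv_sqrt3; field.
rewrite (integral_segment_split _ _ _ _ measurable_density a0 ar).
rewrite integral_density_le_third ?sa// integral_density_far ?sa//.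
rewrite (cap_third a a0 sa) -EFinD; congr EFin.
by move: (@pi R) p0 => p p0; field.
Qed.

End density_integral.

(** * Hoelder continuity on the half-line *)

Section hoelder.
Context {R : realType}.
Implicit Types r x y : R.

Lemma atan_lipschitz x y : y <= x -> atan x - atan y <= x - y.
Proof.
move=> yx.
have [|c _ ->] := @MVT_segment R atan (fun t => (1 + t ^+ 2)^-1) y x yx.
  by apply: continuous_subspaceT => t; exact: continuous_atan.
rewrite ler_piMl ?subr_ge0// invf_le1 ?lerDl ?sqr_ge0//.
by rewrite (lt_le_trans ltr01)// lerDl sqr_ge0.
Qed.

Lemma sinh_le_cosh r : sinh r <= cosh r.
Proof. by rewrite /sinh /cosh ler_pM2r ?invr_gt0// lerD2l gt0_cp// expR_gt0.
  Qed.

Lemma sinhB_le x y : 0 <= y -> y <= x -> sinh x - sinh y <= cosh x * (x - y).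
Proof.
move=> y0 yx.
have [||c + ->] := @MVT_segment R sinh cosh y x yx.
- by move=> t _; rewrite -[cosh t]mulr1; apply: derive_rule_sinh.
- by apply: continuous_subspaceT; exact: continuous_sinh.
rewrite in_itv/= => /andP[yc cx].
by rewrite ler_wpM2r ?subr_ge0// le_cosh ?(le_trans y0).
Qed.

Lemma cosh_le_expR x y : y <= x -> cosh x <= expR (x - y) * cosh y.
Proof.
move=> yx; rewrite /cosh mulrA ler_pM2r ?invr_gt0// mulrDr -!expRD.
rewrite lerD ?ler_expR//; lra.
Qed.

Lemma sqrtB_le x y : y <= x -> Num.sqrt x - Num.sqrt y <= Num.sqrt (x - y).
Proof.
move=> yx; have [y0|/ltW y0] := leP 0 y; last first.
  by rewrite (ler0_sqrtr y0) subr0 ler_wsqrtr//; lra.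
have x0 := le_trans y0 yx.
rewrite lerBlDr -(@ler_pXn2r _ 2) ?nnegrE ?addr_ge0 ?sqrtr_ge0//.
rewrite sqrrD !sqr_sqrtr ?subr_ge0//.
by have := mulr_ge0 (sqrtr_ge0 (x - y)) (sqrtr_ge0 y); lra.
Qed.

(** Shows the angle as a function of [cosh r] alone, nondecreasing in it. Below the first threshold
    both radicands are negative and both roots are 0. *)
Lemma angle_sqrt r : angle r = atan (Num.sqrt (4 - 5 / cosh r ^+ 2)).
Proof.
have c0 := cosh_gt0 r; have cs := cosh2Dsinh2 r.
rewrite /angle /width; congr atan.
have -> : 4 - 5 / cosh r ^+ 2 = (4 * sinh r ^+ 2 - 1) * (cosh r)^-1 ^+ 2.
  have -> : sinh r ^+ 2 = cosh r ^+ 2 - 1 by rewrite cs; ring.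
  by field; rewrite gt_eqF.
have [h|/ltW h] := leP 0 (4 * sinh r ^+ 2 - 1).
  by rewrite sqrtrM// sqrtr_sqr ger0_norm// invr_ge0 ltW.
rewrite (ler0_sqrtr h) mul0r ler0_sqrtr// mulr_le0_ge0// sqr_ge0//.
Qed.

(* The factor [sinh y] tames the angle because [ln (cosh _)] is 1-Lipschitz. *)
Lemma sinh_angle_hoelder x y : 0 <= y -> y <= x ->
  0 <= angle x - angle y /\
  sinh y * (angle x - angle y) <= Num.sqrt (10 * (x - y)).
Proof.
move=> y0 yx; have x0 := le_trans y0 yx.
have cy := cosh_gt0 y; have cx := cosh_gt0 x.
have cyx : cosh y <= cosh x by rewrite le_cosh.
have args : 4 - 5 / cosh y ^+ 2 <= 4 - 5 / cosh x ^+ 2.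
  rewrite lerB// ler_pM2l// lef_pV2 ?posrE ?exprn_gt0//.
  by rewrite ler_pXn2r ?nnegrE ?(ltW cx) ?(ltW cy).
have angles : angle y <= angle x.
  by rewrite !angle_sqrt le_atan// ler_wsqrtr.
split; first by rewrite subr_ge0.
apply: (@le_trans _ _ (cosh y * Num.sqrt (5 / cosh y ^+ 2 - 5 / cosh x ^+ 2))).
  apply: ler_pM; rewrite ?subr_ge0 ?sinh_ge0 ?sinh_le_cosh//.
  rewrite !angle_sqrt; apply: le_trans (atan_lipschitz _ _ _) _.
    by rewrite ler_wsqrtr.
  apply: le_trans (sqrtB_le _ _ args) _.
  by rewrite ler_wsqrtr//; lra.
have -> : cosh y * Num.sqrt (5 / cosh y ^+ 2 - 5 / cosh x ^+ 2) =
    Num.sqrt (5 * (1 - (cosh y / cosh x) ^+ 2)).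
  rewrite -[X in X * _](ger0_norm (ltW cy)) -sqrtr_sqr -sqrtrM ?sqr_ge0//.
  by congr Num.sqrt; field; rewrite !gt_eqF.
apply: ler_wsqrtr.
(* [1 - (cosh y / cosh x)^2 <= 1 - exp (- 2 (x - y)) <= 2 (x - y)], whence the constant 10. *)
have : expR (- (x - y)) <= cosh y / cosh x.
  by rewrite ler_pdivlMr// expRN mulrC ler_pdivrMr ?expR_gt0// mulrC
    cosh_le_expR.
have q0 : 0 <= cosh y / cosh x by rewrite divr_ge0 ?(ltW cx) ?(ltW cy).
rewrite -(@ler_pXn2r _ 2) ?nnegrE ?expR_ge0// => h.
have := le_trans (expR_ge1Dx (- (x - y) + - (x - y))) _.
rewrite expRD -expr2 => /(_ _ h); lra.
Qed.

(** In the tail [cosh x (atan 2 - angle x)] is at most [2 cosh x - width x = 5 / (2 cosh x + width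
    x)], which stays bounded. With [6 / pi <= 3] the two ranges give 6 and 15/2. *)
Lemma density_factor_bound x : 0 <= x ->
  0 <= 3 - 6 / pi * (angle x + Num.min (angle x) angle_max) /\
  cosh x * (3 - 6 / pi * (angle x + Num.min (angle x) angle_max)) <= 8.
Proof.
move=> x0; have p0 := pi_gt0 R; have p2 := pi_ge2 R.
have c0 := cosh_gt0 x; have cs := cosh2Dsinh2 x.
have a0 := angle_ge0 x; have a2 := angle_lt_atan2 x.
have p6 : 0 <= (6 / pi : R) <= 3.
  by rewrite divr_ge0 ?(ltW p0)//= ler_pdivrMr//; lra.
have [s3|/ltW s3] := leP (3 * sinh x ^+ 2) 1.
  rewrite min_l ?angle_le//; have am := angle_le x s3.
  rewrite angle_maxE in am; split.
    by rewrite subr_ge0 mulrAC ler_pdivrMr//; lra.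
  have c2 : cosh x <= 2.
    by rewrite -(@ler_pXn2r _ 2) ?nnegrE ?(ltW c0)// cs; lra.
  have := mulr_ge0 (proj1 (andP p6)) (addr_ge0 a0 a0); nra.
rewrite min_r ?angle_ge// angle_maxE.
have -> : 3 - 6 / pi * (angle x + (pi / 2 - atan 2)) =
    6 / pi * (atan 2 - angle x).
  by move: (lt0r_neq0 p0); move: (@pi R) => p p0'; field.
case/andP: p6 => p60 p63; split; first by rewrite mulr_ge0// subr_ge0 (ltW a2).
have w0 := width_ge0 x; have wc := width_ltcosh x.
have w2 : width x ^+ 2 = 4 * sinh x ^+ 2 - 1 by apply: sqr_width; lra.
have c1 := cosh_ge1 x.
have bound : cosh x * (atan 2 - angle x) <= 5 / 2.
  apply: (@le_trans _ _ (cosh x * (2 - width x / cosh x))).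
    by rewrite ler_pM2l// atan_lipschitz// ler_pdivrMr// ltW.
  have -> : cosh x * (2 - width x / cosh x) = 2 * cosh x - width x.
    by field; rewrite gt_eqF.
  have : (2 * cosh x - width x) * (2 * cosh x + width x) = 5.
    transitivity (4 * cosh x ^+ 2 - width x ^+ 2); first by ring.
    by rewrite cs w2; ring.
  nra.
rewrite mulrCA.
have := ler_pM p60 _ p63 bound;
  rewrite mulr_ge0 ?(ltW c0) ?subr_ge0 ?(ltW a2)//.
move=> /(_ isT); lra.
Qed.

(** The increment is split into that of [sinh], controlled by [density_factor_bound], and that of
    the angular factor, controlled by [sinh_angle_hoelder]; [32 = 8 + 24]. *)
Lemma density_hoelder_le x y : 0 <= y -> y <= x ->
  `|density x - density y| <= 32 * Num.sqrt (x - y).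
Proof.
move=> y0 yx; have x0 := le_trans y0 yx.
have p0 := pi_gt0 R; have p2 := pi_ge2 R.
have [gx0 gx8] := density_factor_bound x x0.
have [a0 a10] := sinh_angle_hoelder x y y0 yx.
rewrite /density; set gx := (3 - _) in gx0 gx8 *; set gy := (3 - _).
have -> : sinh x * gx - sinh y * gy = (sinh x - sinh y) * gx - sinh y * (gy -
  gx).
  by ring.
have sy0 := sinh_ge0 y y0; have sxy : 0 <= sinh x - sinh y.
  by rewrite subr_ge0 le_sinh.
have gyx : gy - gx = 6 / pi * ((angle x - angle y) +
    (Num.min (angle x) angle_max - Num.min (angle y) angle_max)).
  by rewrite /gx /gy; ring.
have mins : 0 <= Num.min (angle x) angle_max - Num.min (angle y) angle_max
    <= angle x - angle y.
  by rewrite !minEle; case: ifP => ?; case: ifP => ?; lra.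
have p6 : 0 <= (6 / pi : R) <= 3.
  by rewrite divr_ge0 ?(ltW p0)//= ler_pdivrMr//; lra.
set q := Num.sqrt (x - y); have q0 : 0 <= q by exact: sqrtr_ge0.
have q2 : q ^+ 2 = x - y by rewrite sqr_sqrtr// subr_ge0.
have q10 : Num.sqrt (10 * (x - y)) <= 4 * q.
  rewrite -(@ler_pXn2r _ 2) ?nnegrE ?mulr_ge0 ?sqrtr_ge0// exprMn q2.
  by rewrite sqr_sqrtr ?mulr_ge0 ?subr_ge0//; lra.
(* Bounded by [8 q^2] and by 8, hence by [8 q] both for [q <= 1] and for [q >= 1]. *)
have first_term : 0 <= (sinh x - sinh y) * gx <= 8 * q.
  rewrite mulr_ge0//=.
  have h1 : (sinh x - sinh y) * gx <= 8 * q ^+ 2.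
    rewrite q2; apply: le_trans (ler_wpM2r gx0 (sinhB_le _ _ y0 yx)) _.
    by rewrite mulrAC ler_wpM2r ?subr_ge0.
  have h2 : (sinh x - sinh y) * gx <= 8.
    apply: le_trans gx8; apply: ler_wpM2r => //.
    by have := sinh_le_cosh x; lra.
  by have [q1|/ltW q1] := leP q 1; nra.
have second_term : 0 <= sinh y * (gy - gx) <= 24 * q.
  rewrite gyx; have /andP[m0 m1] := mins; have /andP[p60 p63] := p6.
  set A := angle x - angle y in a0 a10 m1 *.
  set M := Num.min _ _ - _ in m0 m1 *.
  have sAM0 : 0 <= sinh y * (A + M) := mulr_ge0 sy0 (addr_ge0 a0 m0).
  have sAM : sinh y * (A + M) <= 8 * q by nra.
  rewrite mulrCA; move: (6 / pi) p60 p63 => k k0 k3.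
  by rewrite mulr_ge0//=; nra.
rewrite ler_norml; lra.
Qed.

Lemma density_hoelder : hoelder_continuous_on `[0, +oo[ (@density R).
Proof.
exists 2^-1, 32; split; rewrite ?invr_gt0//.
  by rewrite invf_le1//; lra.
move=> x y; rewrite /= !in_itv/= !andbT => x0 y0.
rewrite powR12_sqrt//.
have [yx|/ltW xy] := leP y x.
  by rewrite [in leRHS]ger0_norm ?subr_ge0//; exact: density_hoelder_le.
rewrite distrC [in leRHS]distrC [in leRHS]ger0_norm ?subr_ge0//.
exact: density_hoelder_le.
Qed.

End hoelder.

(** * Area of the balls *)

Section slices.
Context {R : realType}.
Implicit Types x y a b c s : R.

Let mu := @lebesgue_measure R.

Lemma measurable_inv_sqr : measurable_fun (`]0, +oo[%classic : set R)
  (fun y : R => y ^- 2).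
Proof.
apply: open_continuous_measurable_fun => // y.
rewrite inE/= in_itv/= andbT => y0; continuous_tac.
by rewrite expf_neq0// gt_eqF.
Qed.

Lemma measurable_inv_sqr_itv a (i : bool) (b : itv_bound R) : 0 < a ->
  measurable_fun ([set` Interval (BSide i a) b] : set R)
    (fun y : R => (y ^- 2)%:E).
Proof.
move=> a0; apply/measurable_EFinP;
  apply: measurable_funS measurable_inv_sqr => //.
apply: subset_itv; first by case: i; rewrite bnd_simp// ltW.
by case: b => [[] ?|[]]; rewrite ?bnd_simp.
Qed.

Lemma integral_inv_sqr a b : 0 < a -> a <= b ->
  (\int[mu]_(y in `[a, b]) (y ^- 2)%:E = (a^-1 - b^-1)%:E)%E.
Proof.
move=> a0 ab.
have pos y : y \in `[a, b] -> y != 0.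
  by rewrite in_itv/= => /andP[ay _]; rewrite gt_eqF// (lt_le_trans a0).
rewrite (FTC_segment (fun y => y ^- 2) (fun y => - y^-1) _ _ ab); first last.
- move=> y yab; have y0 : y != 0 by apply: pos; apply: subset_itv_oo_cc yab.
  by derive_tac => //; rewrite expr2; field.
- by move=> y /pos y0; continuous_tac.
- by move=> y /pos y0; continuous_tac; rewrite expf_neq0.
by congr EFin; ring.
Qed.

Lemma integral_inv_sqr_co a b : 0 < a -> a <= b ->
  (\int[mu]_(y in `[a, b[) (y ^- 2)%:E = (a^-1 - b^-1)%:E)%E.
Proof.
move=> a0 ab; rewrite -integral_inv_sqr//.
by rewrite integral_itv_bndo_bndc//; exact: measurable_inv_sqr_itv.
Qed.

Lemma integral_inv_sqr_oo a b : 0 < a -> a <= b ->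
  (\int[mu]_(y in `]a, b[) (y ^- 2)%:E = (a^-1 - b^-1)%:E)%E.
Proof.
move=> a0 ab; rewrite -integral_inv_sqr//.
rewrite integral_itv_bndo_bndc; last exact: measurable_inv_sqr_itv.
by rewrite integral_itv_obnd_cbnd//; exact: measurable_inv_sqr_itv.
Qed.

Lemma integral_inv_sqr_cy a : 0 < a ->
  (\int[mu]_(y in `[a, +oo[%classic) (y ^- 2)%:E = (a^-1)%:E)%E.
Proof.
move=> a0.
have der (y : R) : a <= y -> is_derive y 1 (fun z : R => - z^-1) (y ^- 2).
  move=> ay; have y0 : y != 0 by rewrite gt_eqF// (lt_le_trans a0).
  by derive_tac => //; rewrite expr2; field.
rewrite (@ge0_continuous_FTC2y _ (fun y => y ^- 2) (fun y => - y^-1) a 0).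
- by rewrite -EFinB sub0r opprK.
- by move=> y _; rewrite invr_ge0 sqr_ge0.
- apply: continuous_in_subspaceT => y /set_mem; rewrite /= in_itv/= andbT => ay.
  by continuous_tac; rewrite expf_neq0// gt_eqF// (lt_le_trans a0).
- rewrite -oppr0; apply: cvgN; apply/(gtr0_cvgV0 (f := id)) => //.
  exact: nbhs_pinfty_gt.
- by move=> y /ltW /der [].
- by apply: cvg_at_right_filter; apply: is_derive_continuous (der a _).
- by move=> y; rewrite in_itv/= andbT => /ltW /der /is_derive_derive1.
Qed.

(* With [c = cosh r] and [s = sinh r], the two circles [|z| = 1] and
   [|z - i c| = s] meet at [|x| = s / c]. *)
Definition slice c s x : R :=
  if x ^+ 2 * c ^+ 2 <= s ^+ 2 then
    (Num.sqrt (1 - x ^+ 2))^-1 - (c - Num.sqrt (s ^+ 2 - x ^+ 2)) / (1 + x ^+ 2)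
  else 2 * Num.sqrt (s ^+ 2 - x ^+ 2) / (1 + x ^+ 2).

Definition disc_section c x : set R := [set y | [/\ 0 < y,
  1 <= x ^+ 2 + y ^+ 2 & x ^+ 2 + y ^+ 2 + 1 < 2 * y * c]].

(** The section runs from the larger of [h] and [c - q] up to [c + q]. As
    [(c - q) (c + q) = 1 + x^2], the reciprocals of the chord ends have the common denominator of
    [slice]. *)
Lemma integral_slice c s x : 0 < c -> 0 < s -> c ^+ 2 = 1 + s ^+ 2 ->
  x ^+ 2 < 1 ->
  (\int[mu]_(y in disc_section c x) (y ^- 2)%:E = (slice c s x)%:E)%E.
Proof.
move=> c0 s0 cs x1; rewrite /slice.
set h := Num.sqrt (1 - x ^+ 2); set q := Num.sqrt (s ^+ 2 - x ^+ 2).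
have h0 : 0 < h by rewrite sqrtr_gt0 subr_gt0.
have h2 : h ^+ 2 = 1 - x ^+ 2 by rewrite sqr_sqrtr//; lra.
have q0 : 0 <= q by exact: sqrtr_ge0.
have x20 := sqr_ge0 x.
have hle y : 0 < y -> (1 <= x ^+ 2 + y ^+ 2) = (h <= y).
  move=> y0; rewrite -[in RHS](@ler_pXn2r _ 2) ?nnegrE ?(ltW y0) ?(ltW h0)// h2.
  by rewrite lerBlDl.
have [xs|sx] := ltP (s ^+ 2) (x ^+ 2).
  have -> : disc_section c x = set0.
    apply/seteqP; split=> y //= [_ _ yc].
    by have := sqr_ge0 (y - c); lra.
  rewrite integral_set0; have -> : q = 0 by rewrite /q ler0_sqrtr//; lra.
  by rewrite mulr0 mul0r ifF//; apply/negP; nra.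
have q2 : q ^+ 2 = s ^+ 2 - x ^+ 2 by rewrite sqr_sqrtr// subr_ge0.
have qc : q < c by rewrite -(@ltr_pXn2r _ 2) ?nnegrE ?(ltW c0)// q2; lra.
have disc y : (x ^+ 2 + y ^+ 2 + 1 < 2 * y * c) = (c - q < y < c + q).
  rewrite -ltr_distlC -[in RHS](@ltr_pXn2r _ 2) ?nnegrE//.
  rewrite real_normK ?num_real// q2; apply/idP/idP; lra.
have den : (c - q) * (c + q) = 1 + x ^+ 2.
  by transitivity (c ^+ 2 - q ^+ 2); [ring|rewrite cs q2; ring].
have cqp : 0 < c + q by lra.
have cqm : 0 < c - q by lra.
have inv_p : (c + q)^-1 = (c - q) / (1 + x ^+ 2).
  by rewrite -den; field; rewrite !gt_eqF.
have inv_m : (c - q)^-1 = (c + q) / (1 + x ^+ 2).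
  by rewrite -den; field; rewrite !gt_eqF.
have c1 : 1 <= c.
  by rewrite -(@ler_pXn2r _ 2) ?nnegrE ?(ltW c0)// cs expr1n lerDl sqr_ge0.
have h1 : h <= 1.
  by rewrite -(@ler_pXn2r _ 2) ?nnegrE ?(ltW h0)// h2 expr1n; lra.
have hc_eq : h ^+ 2 * c ^+ 2 = 1 + s ^+ 2 - x ^+ 2 * c ^+ 2.
  by rewrite h2 cs; ring.
have [hin|hout] := ltP (c - q) h.
  rewrite ifT.
    have -> : disc_section c x = `[h, c + q[%classic.
      apply/seteqP; split=> y; rewrite /disc_section /= in_itv/= disc.
        by move=> [y0]; rewrite hle// => -> /andP[].
      move=> /andP[hy ycq]; have y0 := lt_le_trans h0 hy.
      by rewrite hle// hy ycq (lt_le_trans hin hy).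
    by rewrite integral_inv_sqr_co// ?inv_p//; lra.
  rewrite leNgt; apply/negP => xc.
  have hc : (h * c) ^+ 2 < 1 by rewrite exprMn hc_eq; lra.
  have {}hc : h * c < 1 by rewrite -(@ltr_pXn2r _ 2) ?nnegrE ?mulr_ge0 ?ltW//
    expr1n.
  have := disc h; rewrite hin h2.
  by move: (h < c + q) => -[]; nra.
have -> : disc_section c x = `]c - q, c + q[%classic.
  apply/seteqP; split=> y; rewrite /disc_section /= in_itv/= disc;
    first by case.
  move=> /andP[cqy ->]; have y0 := lt_trans cqm cqy.
  by rewrite hle// cqy (le_trans hout (ltW cqy)).
rewrite integral_inv_sqr_oo//; last by lra.
rewrite inv_p; case: ifPn => [xc|_]; last first.
  by rewrite inv_m; congr EFin; rewrite -mulrBl; congr (_ / _); ring.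
(* Only the meeting point of the two circles is left, where both branches of [slice] agree. *)
suff -> : h = c - q by [].
have hc : 1 ^+ 2 <= (h * c) ^+ 2 by rewrite exprMn hc_eq; lra.
have {}hc : 1 <= h * c.
  by move: hc; rewrite ler_pXn2r ?nnegrE ?mulr_ge0 ?(ltW h0) ?(ltW c0).
by nra.
Qed.

End slices.

(** * Integrating even functions over symmetric segments *)

Section even_integrals.
Context {R : realType}.
Implicit Types (g e F : R -> R) (a b c v w : R).

Let mu := @lebesgue_measure R.

Definition even_integral g a b v : Prop :=
  (\int[mu]_(x in `[a, b]) (g x)%:E = v%:E)%E /\
  (\int[mu]_(x in `[(- b)%R, (- a)%R]) (g x)%:E = v%:E)%E.

Lemma even_integral_cat g a b c v w : measurable_fun setT g ->
  a <= b -> b <= c -> even_integral g a b v -> even_integral g b c w ->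
  even_integral g a c (v + w).
Proof.
move=> mg ab bc [v1 v2] [w1 w2]; split.
  by rewrite (integral_segment_split _ _ _ _ mg ab bc) v1 w1 EFinD.
rewrite (@integral_segment_split _ _ _ (- b)) ?lerN2//.
by rewrite v2 w2 -EFinD addrC.
Qed.

Lemma even_integral_sym g b v : measurable_fun setT g -> 0 <= b ->
  even_integral g 0 b v ->
  (\int[mu]_(x in `[(- b)%R, b]) (g x)%:E = (2 * v)%:E)%E.
Proof.
rewrite /even_integral oppr0 => mg b0 [v1 v2].
rewrite (@integral_segment_split _ _ _ 0) ?oppr_le0//.
by rewrite v1 v2 -EFinD; congr EFin; ring.
Qed.

(** [e] is the continuous formula that the piecewise [g] follows on the segment. The mirrored
    integral is computed with the primitive [- F (- x)]. *)
Lemma even_integral_FTC g e F a b : a <= b -> (forall x, g (- x) = g x) ->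
  (forall x, x \in `[a, b] -> g x = e x) ->
  (forall x, x \in `[a, b] -> continuous_at x e) ->
  (forall x, x \in `[a, b] -> continuous_at x F) ->
  (forall x : R, x \in `]a, b[ -> is_derive x 1 F (e x)) ->
  even_integral g a b (F b - F a).
Proof.
move=> ab g_even ge ce cF dF; split.
  rewrite -(FTC_segment e F a b ab)//; apply: eq_integral => x.
  by rewrite inE/= => /ge ->.
have Ncc x : x \in `[- b, - a] -> - x \in `[a, b].
  by rewrite !in_itv/= => /andP[bx xa]; rewrite lerNr xa lerNl bx.
have Noo x : x \in `]- b, - a[ -> - x \in `]a, b[.
  by rewrite !in_itv/= => /andP[bx xa]; rewrite ltrNr xa ltrNl bx.
have cN x : continuous_at x (fun t : R => - t) by continuous_tac.
transitivity (\int[mu]_(x in `[(- b)%R, (- a)%R]) (e (- x))%:E)%E.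
  by apply: eq_integral => x; rewrite inE/= => /Ncc /ge <-; rewrite g_even.
rewrite (FTC_segment (fun x => e (- x)) (fun x => - F (- x))) ?lerN2//.
- by congr EFin; rewrite !opprK addrC.
- move=> x /Ncc /ce cx.
  exact: (@continuous_comp _ _ _ (fun t => - t) e x (cN x) cx).
- move=> x /Ncc /cF cx; apply: continuous_rule_opp.
  exact: (@continuous_comp _ _ _ (fun t => - t) F x (cN x) cx).
- move=> x /Noo /dF dx.
  have dFN := derive_rule_comp _ _ _ _ _ dx (derive_rule_opp _ _ _
    (derive_rule_id x)).
  by derive_tac; ring.
Qed.

End even_integrals.

(** * Primitives of the slices *)

Section slice_antiderivatives.
Context {R : realType}.
Implicit Types (x c k s : R).

(** For [c = 1] the function is [arcsin (x / sqrt k)]. For [k = s^2] and [c^2 = 1 + s^2] the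
    denominator factors through [s^2 (1 + x^2)], as in the slices. *)
Lemma is_derive_atan_ratio c k x : x ^+ 2 < k ->
  is_derive x 1 (fun t => atan (c * t / Num.sqrt (k - t ^+ 2)))
    (c * k / (Num.sqrt (k - x ^+ 2) * (k - x ^+ 2 + c ^+ 2 * x ^+ 2))).
Proof.
move=> xk; set q := Num.sqrt (k - x ^+ 2).
have q0 : 0 < q by rewrite sqrtr_gt0 subr_gt0.
have q2 : q ^+ 2 = k - x ^+ 2 by rewrite sqr_sqrtr//; lra.
have den0 : 0 < q ^+ 2 + c ^+ 2 * x ^+ 2.
  by apply: ltr_wpDr; [rewrite mulr_ge0 ?sqr_ge0|rewrite exprn_gt0].
derive_tac; [by rewrite gt_eqF|by rewrite subr_gt0|].
rewrite -/q /= -q2; have -> : k = q ^+ 2 + x ^+ 2 by rewrite q2; ring.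
have -> : 1 + (c * x / q) ^+ 2 = (q ^+ 2 + c ^+ 2 * x ^+ 2) / q ^+ 2.
  by field; rewrite gt_eqF.
by field; rewrite exprMn !gt_eqF.
Qed.

(** The reciprocal ratio stays continuous where the root vanishes, so the outer primitive can be
    used up to [x = s]. *)
Lemma is_derive_atan_ratio_inv c k x : c != 0 -> 0 < x -> x ^+ 2 < k ->
  is_derive x 1 (fun t => atan (Num.sqrt (k - t ^+ 2) / (c * t)))
    (- (c * k / (Num.sqrt (k - x ^+ 2) * (k - x ^+ 2 + c ^+ 2 * x ^+ 2)))).
Proof.
move=> c0 x0 xk; set q := Num.sqrt (k - x ^+ 2).
have q0 : 0 < q by rewrite sqrtr_gt0 subr_gt0.
have q2 : q ^+ 2 = k - x ^+ 2 by rewrite sqr_sqrtr//; lra.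
have den0 : 0 < q ^+ 2 + c ^+ 2 * x ^+ 2.
  by apply: ltr_wpDr; [rewrite mulr_ge0 ?sqr_ge0|rewrite exprn_gt0].
have x_neq0 := lt0r_neq0 x0.
derive_tac; [by rewrite subr_gt0|by rewrite mulf_neq0|].
rewrite -/q /= -q2; have -> : k = q ^+ 2 + x ^+ 2 by rewrite q2; ring.
have -> : 1 + (q / (c * x)) ^+ 2 = (q ^+ 2 + c ^+ 2 * x ^+ 2) / (c * x) ^+ 2.
  by field; rewrite c0 x_neq0.
by field; rewrite exprMn c0 x_neq0 !gt_eqF.
Qed.

Lemma slice_even c s x : slice c s (- x) = slice c s x.
Proof. by rewrite /slice !sqrrN. Qed.

Lemma measurable_invr : measurable_fun setT (fun x : R => x^-1).
Proof.
rewrite -(setvU [set 0 : R]); apply/measurable_funU => //.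
  exact: measurableC.
split; last exact: measurable_fun_set1.
apply: open_continuous_measurable_fun; first exact: closed_openC.
move=> x /set_mem /= x0; continuous_tac.
exact/eqP.
Qed.

Lemma measurable_sqrt_sub k : measurable_fun setT (fun x : R =>
  Num.sqrt (k - x ^+ 2)).
Proof.
by apply: continuous_measurable_fun => x; continuous_tac.
Qed.

Lemma measurable_slice c s : measurable_fun setT (slice c s).
Proof.
have mx2 : measurable_fun setT (fun x : R => 1 + x ^+ 2).
  by apply: continuous_measurable_fun => x; continuous_tac.
have mi (f : R -> R) : measurable_fun setT f -> measurable_fun setT (fun x =>
  (f x)^-1).
  by move=> mf; exact: measurableT_comp measurable_invr mf.
apply: measurable_fun_ifT.
- apply: measurable_fun_ler => //.
  by apply: continuous_measurable_fun => x; continuous_tac.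
- apply: measurable_funB; first by apply: mi; exact: measurable_sqrt_sub.
  apply: measurable_funM; last exact: mi.
  by apply: measurable_funB => //; exact: measurable_sqrt_sub.
- apply: measurable_funM; last exact: mi.
  by apply: measurable_funM => //; exact: measurable_sqrt_sub.
Qed.

(* The factors [1 *] make every term an instance of [is_derive_atan_ratio]. *)
Definition inner_primitive c s x : R :=
  atan (1 * x / Num.sqrt (1 - x ^+ 2)) - c * atan x +
  (c * atan (c * x / Num.sqrt (s ^+ 2 - x ^+ 2)) -
   atan (1 * x / Num.sqrt (s ^+ 2 - x ^+ 2))).

Definition outer_primitive c s x : R :=
  2 * atan (Num.sqrt (s ^+ 2 - x ^+ 2) / (1 * x)) -
  2 * c * atan (Num.sqrt (s ^+ 2 - x ^+ 2) / (c * x)).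

Lemma even_integral_inner c s b : 0 <= b -> 0 < s -> 1 < c ->
  c ^+ 2 = 1 + s ^+ 2 -> b ^+ 2 * c ^+ 2 <= s ^+ 2 ->
  even_integral (slice c s) 0 b (inner_primitive c s b).
Proof.
move=> b0 s0 c1 cs bc.
have bound x : x \in `[0, b] ->
    [/\ x ^+ 2 * c ^+ 2 <= s ^+ 2, x ^+ 2 < s ^+ 2 & x ^+ 2 < 1].
  rewrite in_itv/= => /andP[x0 xb].
  have xxbb : x ^+ 2 <= b ^+ 2 by rewrite ler_pXn2r.
  have c2 : 0 < c ^+ 2 by nra.
  have h : x ^+ 2 * c ^+ 2 <= s ^+ 2 by apply: le_trans bc; rewrite ler_pM2r.
  have s2 : 0 < s ^+ 2 by rewrite exprn_gt0.
  have x2 := sqr_ge0 x; move: (x ^+ 2) (s ^+ 2) (c ^+ 2) cs h s2 x2 c2 => X S C.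
  move=> CS XCS S0 X0 C0; have : 0 < S * (C - 1) by rewrite mulr_gt0//; lra.
  by split; nra.
have -> : inner_primitive c s b = inner_primitive c s b - inner_primitive c s 0.
  by rewrite {3}/inner_primitive !mulr0 !mul0r atan0 !mulr0 !subr0 addr0 subr0.
apply: (@even_integral_FTC _ _ (fun x => (Num.sqrt (1 - x ^+ 2))^-1 -
    (c - Num.sqrt (s ^+ 2 - x ^+ 2)) / (1 + x ^+ 2))) => //.
- exact: slice_even.
- by move=> x /bound [h _ _]; rewrite /slice h.
- move=> x /bound [_ xs x1]; continuous_tac.
    by rewrite gt_eqF// sqrtr_gt0 subr_gt0.
  by rewrite gt_eqF// ltr_wpDr ?sqr_ge0.
- move=> x /bound [_ xs x1]; rewrite /inner_primitive; continuous_tac;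
  by rewrite gt_eqF// sqrtr_gt0 subr_gt0.
- move=> x xb; have [_ xs x1] := bound _ (subset_itv_oo_cc xb).
  have d1 := is_derive_atan_ratio 1 _ _ x1.
  have d2 := is_derive_atan_ratio c _ _ xs.
  have d3 := is_derive_atan_ratio 1 _ _ xs.
  have h0 : 0 < Num.sqrt (1 - x ^+ 2) by rewrite sqrtr_gt0 subr_gt0.
  have q0 : 0 < Num.sqrt (s ^+ 2 - x ^+ 2) by rewrite sqrtr_gt0 subr_gt0.
  have q2 : Num.sqrt (s ^+ 2 - x ^+ 2) ^+ 2 = s ^+ 2 - x ^+ 2.
    by rewrite sqr_sqrtr//; lra.
  have x20 := sqr_ge0 x.
  rewrite /inner_primitive; derive_tac.
  move: (Num.sqrt (1 - x ^+ 2)) (Num.sqrt (s ^+ 2 - x ^+ 2)) h0 q0 q2.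
  move=> h q h0 q0 q2.
  have -> : 1 - x ^+ 2 + 1 ^+ 2 * x ^+ 2 = 1 by ring.
  have -> : s ^+ 2 - x ^+ 2 + 1 ^+ 2 * x ^+ 2 = s ^+ 2 by ring.
  have -> : s ^+ 2 - x ^+ 2 + c ^+ 2 * x ^+ 2 = s ^+ 2 * (1 + x ^+ 2).
    by rewrite cs; ring.
  have xx : 1 + x ^+ 2 != 0 by rewrite gt_eqF//; lra.
  (* Writing [q] as [q^2 / q] splits the slice into the two terms that the primitives produce. *)
  have num : q = (c ^+ 2 - (1 + x ^+ 2)) / q.
    by apply: (mulIf (lt0r_neq0 q0)); rewrite /= divfK ?gt_eqF// -expr2 q2 cs;
      ring.
  rewrite [in RHS]num; field.
  by rewrite xx !gt_eqF.
Qed.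

Lemma even_integral_outer c s a b : 0 < a -> a <= b -> b <= s -> 1 < c ->
  c ^+ 2 = 1 + s ^+ 2 -> a * c = s ->
  even_integral (slice c s) a b (outer_primitive c s b - outer_primitive c s a).
Proof.
move=> a0 ab bs c1 cs ac.
have c0 : 0 < c by lra.
have s0 : 0 < s by rewrite -ac mulr_gt0.
have bound x : x \in `[a, b] -> [/\ 0 < x, a <= x & x <= s].
  rewrite in_itv/= => /andP[ax xb]; split=> //; last exact: le_trans xb bs.
  exact: lt_le_trans a0 ax.
apply: (@even_integral_FTC _ _
    (fun x => 2 * Num.sqrt (s ^+ 2 - x ^+ 2) / (1 + x ^+ 2))) => //.
- exact: slice_even.
- move=> x /bound [x0 ax xs]; rewrite /slice; case: ifPn => // xc.
  (* At the left end the test of [slice] is an equality and selects the first branch; the two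
     branches have the same value there. *)
  have xa : x = a.
    apply/eqP; rewrite eq_le ax andbT -(ler_pM2r c0) ac.
    rewrite -(@ler_pXn2r _ 2) ?nnegrE ?mulr_ge0 ?(ltW s0) ?(ltW c0) ?(ltW x0)//.
    by rewrite exprMn.
  have h : Num.sqrt (1 - x ^+ 2) = c^-1.
    rewrite -[RHS]ger0_norm ?invr_ge0 ?(ltW c0)// -sqrtr_sqr; congr Num.sqrt.
    apply: (mulIf (x := c ^+ 2)); first by rewrite gt_eqF ?exprn_gt0.
    by rewrite exprVn mulVf ?gt_eqF ?exprn_gt0// mulrBl -exprMn xa ac cs; ring.
  have q : Num.sqrt (s ^+ 2 - x ^+ 2) = s ^+ 2 / c.
    rewrite -[RHS]ger0_norm ?divr_ge0 ?sqr_ge0 ?(ltW c0)// -sqrtr_sqr.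
    congr Num.sqrt; apply: (mulIf (x := c ^+ 2)).
      by rewrite gt_eqF ?exprn_gt0.
    rewrite mulrBl -[x ^+ 2 * _]exprMn xa ac expr_div_n divfK ?gt_eqF
      ?exprn_gt0// cs; ring.
  have xE : x ^+ 2 = s ^+ 2 / c ^+ 2.
    by rewrite xa -ac exprMn mulfK// gt_eqF// exprn_gt0.
  rewrite h q invrK xE.
  have s2 : s ^+ 2 = c ^+ 2 - 1 by rewrite cs; ring.
  rewrite s2; field; rewrite gt_eqF//=.
  by rewrite gt_eqF//; nra.
- move=> x /bound [x0 ax xs]; continuous_tac.
  by rewrite gt_eqF// ltr_wpDr ?sqr_ge0.
- move=> x /bound [x0 ax xs]; rewrite /outer_primitive; continuous_tac;
  by rewrite mulf_neq0// ?gt_eqF.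
- move=> x xab; have [x0 ax _] := bound _ (subset_itv_oo_cc xab).
  have xs : x ^+ 2 < s ^+ 2.
    have {}xs : x < s by move: xab; rewrite in_itv/= => /andP[_ xb]; lra.
    by rewrite ltr_pXn2r ?nnegrE ?(ltW x0) ?(ltW s0).
  have d1 := is_derive_atan_ratio_inv 1 _ _ (oner_neq0 R) x0 xs.
  have d2 := is_derive_atan_ratio_inv c _ _ (lt0r_neq0 c0) x0 xs.
  have q0 : 0 < Num.sqrt (s ^+ 2 - x ^+ 2) by rewrite sqrtr_gt0 subr_gt0.
  have q2 : Num.sqrt (s ^+ 2 - x ^+ 2) ^+ 2 = s ^+ 2 - x ^+ 2.
    by rewrite sqr_sqrtr//; lra.
  have x20 := sqr_ge0 x.
  rewrite /outer_primitive; derive_tac.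
  move: (Num.sqrt (s ^+ 2 - x ^+ 2)) q0 q2 => q q0 q2.
  have -> : s ^+ 2 - x ^+ 2 + 1 ^+ 2 * x ^+ 2 = s ^+ 2 by ring.
  have -> : s ^+ 2 - x ^+ 2 + c ^+ 2 * x ^+ 2 = s ^+ 2 * (1 + x ^+ 2).
    by rewrite cs; ring.
  have xx : 1 + x ^+ 2 != 0 by rewrite gt_eqF//; lra.
  have num : q = (c ^+ 2 - (1 + x ^+ 2)) / q.
    by apply: (mulIf (lt0r_neq0 q0)); rewrite /= divfK ?gt_eqF// -expr2 q2 cs;
      ring.
  rewrite [in RHS]num; field.
  by rewrite xx !gt_eqF.
Qed.

Lemma even_integral_null c s a b : 0 < s -> c ^+ 2 = 1 + s ^+ 2 ->
  s <= a -> a <= b -> even_integral (slice c s) a b 0.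
Proof.
move=> s0 cs sa ab; rewrite -[X in even_integral _ _ _ X](subrr (0 : R)).
apply: (@even_integral_FTC _ _ (fun=> 0) (fun=> 0)) => //.
- exact: slice_even.
- move=> x; rewrite in_itv/= => /andP[ax _].
  have sx : s ^+ 2 <= x ^+ 2.
    have h := le_trans sa ax.
    by rewrite ler_pXn2r ?nnegrE ?(ltW s0) ?(le_trans (ltW s0)).
  have s2 : 0 < s ^+ 2 by rewrite exprn_gt0.
  rewrite /slice ifF; last by apply/negP; have := mulr_gt0 s2 s2; rewrite cs;
    nra.
  by rewrite ler0_sqrtr ?subr_le0// mulr0 mul0r.
- by move=> x _; continuous_tac.
- by move=> x _; continuous_tac.
Qed.

End slice_antiderivatives.

(** * Areas in closed form *)

Section slice_integral.
Context {R : realType}.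
Implicit Types r : R.

Let mu := @lebesgue_measure R.

Lemma sqrt_unique (x y : R) : 0 <= y -> y ^+ 2 = x -> Num.sqrt x = y.
Proof. by move=> y0 <-; rewrite sqrtr_sqr ger0_norm. Qed.

Lemma cosh_gt1 r : 0 < r -> 1 < cosh r.
Proof. by move=> r0; rewrite -[ltLHS]cosh0 lt_cosh// ltW. Qed.

Lemma sqrt_half_width r : 1 <= 4 * sinh r ^+ 2 ->
  Num.sqrt (sinh r ^+ 2 - (1 / 2) ^+ 2) = width r / 2.
Proof.
move=> s4; apply: sqrt_unique; first by rewrite divr_ge0 ?width_ge0.
by rewrite expr_div_n sqr_width//; field.
Qed.

(** The inner branch runs up to [s / c], the outer one from there to [s] or [1/2], whichever comes
    first. The outer primitive is [- 2 cap r] at [1/2] and 0 at [s], the latter in accordance with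
    [cap r = 0] in that case. *)
Lemma integral_slice_le_third r : 0 < r -> 3 * sinh r ^+ 2 <= 1 ->
  (\int[mu]_(x in `[(- (1 / 2))%R, (1 / 2)%R]) (slice (cosh r) (sinh r) x)%:E =
   (pi * (cosh r - 1) - 4 * cap r)%:E)%E.
Proof.
move=> r0 s3; have c1 := cosh_gt1 r r0; have s0 := sinh_gt0 r r0.
have cs := cosh2Dsinh2 r; have mS := measurable_slice (cosh r) (sinh r).
have outer_cap : 1 <= 4 * sinh r ^+ 2 ->
    outer_primitive (cosh r) (sinh r) (1 / 2) = - (2 * cap r).
  move=> s4; rewrite /outer_primitive sqrt_half_width// /cap /angle.
  have -> : width r / 2 / (1 * (1 / 2)) = width r by field.
  have -> : width r / 2 / (cosh r * (1 / 2)) = width r / cosh r.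
    by field; rewrite gt_eqF//; lra.
  by ring.
move: outer_cap; set c := cosh r in c1 cs mS *; set s :=
  sinh r in s0 s3 cs mS *.
move=> outer_cap.
have c0 : 0 < c by lra.
have s_neq0 := lt0r_neq0 s0; have c_neq0 := lt0r_neq0 c0.
have t0 : 0 < s / c by rewrite divr_gt0.
have tc : s / c * c = s by rewrite divfK.
have ts : s / c <= s by rewrite ler_pdivrMr//; nra.
have t12 : s / c <= 1 / 2.
  rewrite ler_pdivrMr// -(@ler_pXn2r _ 2) ?nnegrE ?(ltW s0) ?mulr_ge0 ?(ltW
    c0)//.
  by rewrite [leRHS]exprMn cs; lra.
have inner : even_integral (slice c s) 0 (s / c) (inner_primitive c s (s / c)).
  by apply: even_integral_inner; rewrite ?(ltW t0)// -exprMn tc.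
have E : even_integral (slice c s) 0 (1 / 2) (inner_primitive c s (s / c) +
    (- (2 * cap r) - outer_primitive c s (s / c))).
  apply: (even_integral_cat _ _ _ _ _ _ mS (ltW t0) t12 inner).
  have [s4|/ltW s4] := leP (4 * s ^+ 2) 1.
    have s12 : s <= 1 / 2 by nra.
    rewrite cap_eq0// mulr0 oppr0 -[X in even_integral _ _ _ X]addr0.
    apply: (even_integral_cat _ _ _ _ _ _ mS ts s12).
      have -> : 0 = outer_primitive c s s.
        by rewrite /outer_primitive subrr sqrtr0 !mul0r atan0 !mulr0 subr0.
      exact: even_integral_outer.
    exact: even_integral_null.
  rewrite -outer_cap//; apply: even_integral_outer => //.
  by nra.
rewrite (even_integral_sym _ _ _ mS _ E); last by [].
(* At the junction [x = s / c] the two primitives differ by [(c - 1) pi / 2]: all other arctangents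
   cancel. *)
congr EFin; rewrite /inner_primitive /outer_primitive.
have s2 : s ^+ 2 = c ^+ 2 - 1 by rewrite cs; ring.
have -> : Num.sqrt (1 - (s / c) ^+ 2) = c^-1.
  apply: sqrt_unique; first by rewrite invr_ge0 ltW.
  by rewrite expr_div_n s2; field.
have -> : Num.sqrt (s ^+ 2 - (s / c) ^+ 2) = s ^+ 2 / c.
  apply: sqrt_unique; first by rewrite divr_ge0 ?sqr_ge0 ?ltW.
  rewrite [(s ^+ 2 / c) ^+ 2]expr_div_n [(s / c) ^+ 2]expr_div_n s2.
  by field.
have -> : 1 * (s / c) / c^-1 = s by field; rewrite c_neq0.
have -> : c * (s / c) / (s ^+ 2 / c) = (s / c)^-1.
  by field; rewrite c_neq0 s_neq0.
have -> : 1 * (s / c) / (s ^+ 2 / c) = s^-1 by field; rewrite c_neq0 s_neq0.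
have -> : s ^+ 2 / c / (1 * (s / c)) = s by field; rewrite c_neq0 s_neq0.
have -> : s ^+ 2 / c / (c * (s / c)) = s / c by field; rewrite c_neq0 s_neq0.
rewrite !atan_inv//; move: (@pi R) => p; by field.
Qed.

Lemma half_div_sqrt : 1 * (1 / 2) / Num.sqrt (1 - (1 / 2) ^+ 2) = (Num.sqrt
  3)^-1 :> R.
Proof.
have s3 : 0 < Num.sqrt 3 :> R by rewrite sqrtr_gt0.
have -> : Num.sqrt (1 - (1 / 2) ^+ 2) = Num.sqrt 3 / 2 :> R.
  apply: sqrt_unique; first by rewrite divr_ge0// ltW.
  by rewrite expr_div_n sqr_sqrtr//; field.
by field; rewrite gt_eqF.
Qed.

(** Now [1/2 <= s / c], so only the inner branch occurs. *)
Lemma integral_slice_ge_third r : 0 < r -> 1 <= 3 * sinh r ^+ 2 ->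
  (\int[mu]_(x in `[(- (1 / 2))%R, (1 / 2)%R]) (slice (cosh r) (sinh r) x)%:E =
   (pi * (cosh r - 1) - 2 * cap r - 2 * cosh r * angle_max + pi / 3)%:E)%E.
Proof.
move=> r0 s3; have c1 := cosh_gt1 r r0; have s0 := sinh_gt0 r r0.
have cs := cosh2Dsinh2 r.
have w0 : 0 < width r by apply: width_gt0; lra.
have c0 : 0 < cosh r by lra.
have b0 : 0 <= 1 / 2 :> R by [].
have bc : (1 / 2) ^+ 2 * cosh r ^+ 2 <= sinh r ^+ 2.
  by rewrite cs expr_div_n; lra.
have inner := even_integral_inner _ _ _ b0 s0 c1 cs bc.
rewrite (even_integral_sym _ _ _ (measurable_slice _ _) b0 inner).
congr EFin; rewrite /inner_primitive half_div_sqrt sqrt_half_width; last by lra.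
have -> : cosh r * (1 / 2) / (width r / 2) = (width r / cosh r)^-1.
  by field; rewrite !gt_eqF.
have -> : 1 * (1 / 2) / (width r / 2) = (width r)^-1.
  by field; rewrite !gt_eqF.
have wc0 : 0 < width r / cosh r by rewrite divr_gt0.
rewrite atan_inv_sqrt3 !atan_inv// /cap /angle /angle_max.
move: (@pi R) => p; by field.
Qed.

(** The slices of the whole fundamental domain, each being the integral of [y^-2] above the unit
    circle. *)
Lemma integral_slice_total :
  (\int[mu]_(x in `[(- (1 / 2))%R, (1 / 2)%R]) ((Num.sqrt (1 - x ^+ 2))^-1)%:E =
   (pi / 3)%:E)%E.
Proof.
have bound (x : R) : x \in `[0, 1 / 2] -> x ^+ 2 < 1.
  by rewrite in_itv/= => /andP[x0 x1]; nra.
have pos (x : R) : x ^+ 2 < 1 -> 0 < Num.sqrt (1 - x ^+ 2).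
  by move=> x1; rewrite sqrtr_gt0 subr_gt0.
have E : even_integral (fun x : R => (Num.sqrt (1 - x ^+ 2))^-1) 0 (1 / 2)
    (atan (1 * (1 / 2) / Num.sqrt (1 - (1 / 2) ^+ 2)) -
     atan (1 * 0 / Num.sqrt (1 - 0 ^+ 2))).
  apply: (@even_integral_FTC _ _ (fun x => (Num.sqrt (1 - x ^+ 2))^-1)
     (fun x => atan (1 * x / Num.sqrt (1 - x ^+ 2)))) => //.
  - by move=> x; rewrite sqrrN.
  - by move=> x /bound /pos x1; continuous_tac; rewrite gt_eqF.
  - by move=> x /bound /pos x1; continuous_tac; rewrite gt_eqF.
  - move=> x xb; have x1 := bound _ (subset_itv_oo_cc xb).
    have d1 := is_derive_atan_ratio 1 _ _ x1.
    derive_tac; have := pos _ x1; move: (Num.sqrt _) => h h0.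
    by field; rewrite gt_eqF//= (_ : _ + _ = 1) ?oner_eq0//; ring.
rewrite (even_integral_sym _ _ _ _ _ E)//; last first.
  exact: measurableT_comp measurable_invr (measurable_sqrt_sub 1).
rewrite half_div_sqrt atan_inv_sqrt3 mulr0 mul0r atan0.
by congr EFin; move: (@pi R) => p; field.
Qed.

End slice_integral.

(** * Tonelli's theorem and the area of modular balls *)

Section area_by_slices.
Context {R : realType}.
Implicit Types (r : R) (D : set (R * R)) (S : R -> R).

Let mu := @lebesgue_measure R.

Lemma integral_by_slices (D : set (measurableTypeR R * measurableTypeR R)) S :
  measurable D -> measurable_fun setT S ->
  (forall p, D p -> - 2^-1 < p.1 <= 2^-1) ->
  (forall x, - 2^-1 < x <= 2^-1 ->
    (\int[mu]_(y in [set y | D (x, y)]) (y ^- 2)%:E = (S x)%:E)%E) ->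
  (\int[(mu \x mu)%E]_(p in D) (p.2 ^- 2)%:E =
   \int[mu]_(x in `[(- (1 / 2))%R, (1 / 2)%R]) (S x)%:E)%E.
Proof.
move=> mD mS Dx DS; rewrite integral_mkcond.
have mf : measurable_fun setT ((fun p : measurableTypeR R * measurableTypeR R =>
    (p.2 ^- 2)%:E) \_ D).
  have mp : measurable_fun setT
      (fun p : measurableTypeR R * measurableTypeR R => p.2 ^- 2).
    apply: (measurableT_comp measurable_invr).
    by apply: measurable_funX; exact: measurable_snd.
  apply/(measurable_restrictT _ mD).
  by apply: measurable_funTS; exact/measurable_EFinP.
rewrite fubini_tonelli1//; last first.
  move=> p; rewrite patchE; case: ifP => // _.
  by rewrite lee_fin invr_ge0 sqr_ge0.
rewrite -integral_itv_obnd_cbnd; last first.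
  by apply/measurable_EFinP; exact: measurable_funTS.
rewrite [RHS]integral_mkcond; apply: eq_integral => x _.
rewrite /fubini_F patchE.
transitivity (\int[mu]_(y in [set y | D (x, y)]) (y ^- 2)%:E)%E.
  rewrite [RHS]integral_mkcond; apply: eq_integral => y _.
  by rewrite !patchE; congr (if _ then _ else _); apply/idP/idP;
    rewrite !inE.
rewrite div1r; case: ifPn => [|/negP xI].
  by rewrite inE/= in_itv/= => /DS.
rewrite [X in integral _ X _](_ : _ = set0) ?integral_set0//.
apply/seteqP; split=> y //= /Dx xy; apply: xI.
by rewrite inE/= in_itv.
Qed.

Lemma measurable_lt2 (f g : measurableTypeR R * measurableTypeR R -> R) :
  measurable_fun setT f -> measurable_fun setT g ->
  measurable [set p | f p < g p].
Proof.
move=> mf mg; rewrite -[X in measurable X]setTI.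
by apply: (@measurable_fun_ltr _ _ _ setT f g mf mg measurableT [set true]).
Qed.

Lemma measurable_le2 (f g : measurableTypeR R * measurableTypeR R -> R) :
  measurable_fun setT f -> measurable_fun setT g ->
  measurable [set p | f p <= g p].
Proof.
move=> mf mg; rewrite -[X in measurable X]setTI.
by apply: (@measurable_fun_ler _ _ _ setT f g mf mg measurableT [set true]).
Qed.

Lemma exists_half_plane (p : R * R) : 0 < p.2 ->
  exists z : half_plane R, coords z = p.
Proof.
case: p => x y y0.
by exists (exist (fun s : R[i] => 0 < complex.Im s) (Complex x y) y0).
Qed.

Lemma fundamental_domainE (z : half_plane R) : fundamental_domain z <->
  - 2^-1 < re z <= 2^-1 /\ 1 <= re z ^+ 2 + im z ^+ 2.
Proof.
split=> [zF|[/andP[xl xr] z1]].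
  by split; [case: zF => _ -> ->|exact: fundamental_domain_norm].
split=> //; rewrite normc_def -/(re z) -/(im z) lecR.
by rewrite -[leLHS]sqrtr1 ler_wsqrtr.
Qed.

Let domain : set (measurableTypeR R * measurableTypeR R) :=
  [set p | - 2^-1 < p.1] `&` [set p | p.1 <= 2^-1] `&` [set p | 0 < p.2] `&`
  [set p | 1 <= p.1 ^+ 2 + p.2 ^+ 2].

Let m1 : measurable_fun setT (fun p : measurableTypeR R * measurableTypeR R =>
  p.1).
Proof. exact: measurable_fst. Qed.

Let m2 : measurable_fun setT (fun p : measurableTypeR R * measurableTypeR R =>
  p.2).
Proof. exact: measurable_snd. Qed.

Let msq : measurable_fun setT
  (fun p : measurableTypeR R * measurableTypeR R => p.1 ^+ 2 + p.2 ^+ 2).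
Proof. by apply: measurable_funD; exact: measurable_funX. Qed.

Let measurable_domain : measurable domain.
Proof.
by apply: measurableI; [apply: measurableI; [apply: measurableI|]|];
  (exact: measurable_lt2 || exact: measurable_le2).
Qed.

Lemma hyp_area_fundamental_domain : hyp_area (@fundamental_domain R) = (pi /
  3)%:E.
Proof.
rewrite /hyp_area -integral_slice_total.
have -> : @coords R @` @fundamental_domain R = domain.
  apply/seteqP; split=> [_ [z /fundamental_domainE[/andP[xl xr] z1] <-]|].
    by split=> //; split=> //; exact: im_gt0.
  move=> p [[[xl xr] y0] p1]; have [z zp] := exists_half_plane p y0.
  exists z => //; apply/fundamental_domainE.
  by move: xl xr p1; rewrite -zp /= => -> ->.
apply: integral_by_slices => //.
- exact: measurableT_comp measurable_invr (measurable_sqrt_sub 1).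
- by move=> p [[[/= -> ->]]].
move=> x /andP[xl xr]; have x1 : x ^+ 2 < 1 by nra.
have h0 : 0 < Num.sqrt (1 - x ^+ 2) by rewrite sqrtr_gt0 subr_gt0.
rewrite -integral_inv_sqr_cy//; congr integral.
apply/seteqP; split=> y; rewrite /= in_itv/= andbT.
  move=> [[_ /= y0] /= h]; rewrite -(@ler_pXn2r _ 2) ?nnegrE ?(ltW h0) ?(ltW
    y0)//.
  by rewrite sqr_sqrtr; lra.
move=> hy; have y0 := lt_le_trans h0 hy; split; first by [].
have : Num.sqrt (1 - x ^+ 2) ^+ 2 <= y ^+ 2.
  by rewrite ler_pXn2r ?nnegrE ?(ltW h0) ?(ltW y0).
by rewrite /= sqr_sqrtr; lra.
Qed.

Definition modular_ball r : set (modular_surface R) :=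
  [set p | modular_dist p (@i_star R) < r].

Lemma modular_area_ball r : 0 < r ->
  modular_area (modular_ball r) =
  (\int[mu]_(x in `[(- (1 / 2))%R,
    (1 / 2)%R]) (slice (cosh r) (sinh r) x)%:E)%E.
Proof.
move=> r0; rewrite /modular_area /hyp_area.
have -> : @coords R @` (@fundamental_domain R `&` @modular_proj R @^-1`
  modular_ball r) =
    domain `&` [set p | p.1 ^+ 2 + p.2 ^+ 2 + 1 < 2 * p.2 * cosh r].
  apply/seteqP; split=> [_ [z [zF] zr <-]|].
    have /(modular_dist_lt_domain z r zF)[_ zc] := zr.
    have /fundamental_domainE[/andP[xl xr] z1] := zF.
    by split=> //; split=> //; split=> //; exact: im_gt0.
  move=> p [[[[xl xr] y0] p1] pr]; have [z zp] := exists_half_plane p y0.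
  have zF : fundamental_domain z.
    by apply/fundamental_domainE; move: xl xr p1; rewrite -zp /= => -> ->.
  exists z => //; split=> //; apply/(modular_dist_lt_domain z r zF).
  by split=> //; move: pr; rewrite -zp.
apply: integral_by_slices.
- apply: measurableI => //; apply: measurable_lt2; first exact: measurable_funD.
  by apply: measurable_funM => //; exact: measurable_funM.
- exact: measurable_slice.
- by move=> p [[[[/= -> ->]]]].
move=> x /andP[xl xr]; have x1 : x ^+ 2 < 1 by nra.
rewrite -(integral_slice _ _ _ (cosh_gt0 r) (sinh_gt0 r r0) (cosh2Dsinh2 r) x1).
congr integral; apply/seteqP; split=> y; rewrite /disc_section /=.
  by move=> [[[_ y0] y1] yr].
by move=> [y0 y1 yr].
Qed.

Lemma modular_dist_cdf r : 0 < r ->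
  (modular_area (modular_ball r) / modular_area [set: modular_surface R] =
   \int[mu]_(x in `[0%R, r]) (density x)%:E)%E.
Proof.
move=> r0; rewrite modular_area_ball// /modular_area preimage_setT setIT.
have p3 : (pi / 3 : R) != 0 by rewrite mulf_neq0 ?gt_eqF ?pi_gt0.
rewrite hyp_area_fundamental_domain inver (negbTE p3).
have [s3|/ltW s3] := leP (3 * sinh r ^+ 2) 1.
  rewrite integral_slice_le_third// integral_density_le_third ?(ltW r0)//.
  rewrite -EFinM; congr EFin; rewrite invf_div; exact: mulrC.
rewrite integral_slice_ge_third// integral_density_ge_third ?(ltW r0)//.
rewrite -EFinM; congr EFin; rewrite invf_div; exact: mulrC.
Qed.

End area_by_slices.

(** * Random variables with a prescribed distribution function *)

Section density_of_cdf.
Context {R : realType}.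
Variables (f : R -> R) (mf : measurable_fun setT f).
Hypothesis f_ge0 : forall x, 0 <= x -> 0 <= f x.

Let mu := @lebesgue_measure R.

(** The proofs are arguments so that the canonical measure structure can be recovered from the term
    itself. *)
Definition density_measure (g : R -> R) (mg : measurable_fun setT g)
    (g_ge0 : forall x, 0 <= x -> 0 <= g x) (B : set (measurableTypeR R)) :
      \bar R :=
  (\int[mu]_(x in B `&` `[0%R, +oo[) (g x)%:E)%E.

Let nu := density_measure f mf f_ge0.

Let nu0 : nu set0 = 0%E.
Proof. by rewrite /nu /density_measure set0I integral_set0. Qed.

Let nu_ge0 B : (0 <= nu B)%E.
Proof.
apply: integral_ge0 => x [_]; rewrite /= in_itv/= andbT => x0.
by rewrite lee_fin f_ge0.
Qed.

Let nu_sigma_additive : semi_sigma_additive nu.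
Proof.
move=> F mF tF mUF; apply: cvg_toP.
  apply: ereal_nondecreasing_is_cvgn => m n mn.
  by apply: lee_sum_nneg_natr => // k _ _; exact: nu_ge0.
rewrite /nu /density_measure setI_bigcupl ge0_integral_bigcup//.
- by move=> k; exact: measurableI.
- by apply/measurable_EFinP; exact: measurable_funTS.
- move=> x [k _ [_]]; rewrite /= in_itv/= andbT => x0.
  by rewrite lee_fin f_ge0.
- by apply: trivIset_setIr.
Qed.

HB.instance Definition _ := isMeasure.Build _ _ _ (density_measure f mf f_ge0)
  nu0 nu_ge0 nu_sigma_additive.

(** The rays []-oo, r[] are stable under intersection and generate the Borel sets, and those with
    integer ends exhaust the line with finite mass; two measures that agree on them are equal. *)
Lemma has_density_of_cdf d (Omega : measurableType d) (P : probability Omega R)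
    (X : Omega -> R) : measurable_fun setT X -> (forall w, 0 <= X w) ->
  (forall r, 0 < r -> P [set w | X w < r] = (\int[mu]_(x in `[0%R,
    r]) (f x)%:E)%E) ->
  has_density_on P X `[0, +oo[ f.
Proof.
move=> mX X0 cdf; split=> //; first exact: measurable_funTS.
  by move=> x; rewrite /= in_itv/= andbT; exact: f_ge0.
move=> B mB; have mX' : @measurable_fun _ _ Omega (measurableTypeR R) setT X
  by exact: mX.
pose X' : {mfun Omega >-> measurableTypeR R} :=
  @mfun_Sub _ _ Omega (measurableTypeR R) X (mem_set mX').
rewrite -[LHS]/(distribution P X' B) -[RHS]/(density_measure f mf f_ge0 B).
apply: (@measure_unique _ R (measurableTypeR R) (@RGenInftyO.G R)
  (fun k => `]-oo, k%:R[%classic) _ _ _ _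
  (distribution P X') (density_measure f mf f_ge0)) => //.
- exact: RGenInftyO.measurableE.
- move=> _ _ [a ->] [b ->]; exists (Num.min a b); apply/seteqP; split=> x /=.
    by rewrite !in_itv/= lt_min => -[-> ->].
  by rewrite !in_itv/= lt_min => /andP[-> ->].
- by move=> k; exists k%:R.
- apply/seteqP; split=> // x _; exists (Num.bound `|x|) => //=.
  by rewrite in_itv/= (le_lt_trans (ler_norm x))// archi_boundP.
- move=> _ [r ->]; transitivity (P [set w | X w < r]).
    by congr (P _); apply/seteqP; split=> w /=; rewrite in_itv.
  rewrite -[RHS]/(\int[mu]_(x in `]-oo, r[ `&` `[0%R, +oo[) (f x)%:E)%E.
  have [r0|r0] := leP r 0.
    have -> : [set w | X w < r] = set0.
      by apply/seteqP; split=> w //= /lt_le_trans /(_ r0); rewrite ltNge X0.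
    have -> : `]-oo, r[ `&` `[0, +oo[ = set0 :> set R.
      apply/seteqP; split=> x //=; rewrite !in_itv/= andbT => -[xr x0].
      by have := lt_le_trans xr (le_trans r0 x0); rewrite ltxx.
    by rewrite measure0 integral_set0.
  have -> : `]-oo, r[ `&` `[0, +oo[ = `[0, r[%classic :> set R.
    apply/seteqP; split=> x /=; rewrite !in_itv/= ?andbT.
      by move=> [-> ->].
    by move=> /andP[-> ->].
  rewrite cdf// integral_itv_bndo_bndc//.
  by apply/measurable_EFinP; exact: measurable_funTS.
- by move=> k; rewrite (le_lt_trans (probability_le1 _ _)) ?ltry.
Qed.

End density_of_cdf.

Theorem theorem4p5 (R : realType) (d : measure_display)
    (Omega : measurableType d) (P : probability Omega R)
    (tau : {RV P >-> modular_surface R})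
    (tau_uniform : uniformly_distributed tau) :
  exists T : R -> R,
    [/\ forall r, 0 <= r <= arsinh (1 / 2) ->
          T r = 3 * sinh r,
        forall r, arsinh (1 / 2) <= r <= arsinh (1 / Num.sqrt 3) ->
          T r = sinh r * (3 - 6 / pi *
            atan (4 * cosh r * Num.sqrt (2 * cosh (2 * r) - 3) /
                  (7 - 3 * cosh (2 * r)))),
        forall r, arsinh (1 / Num.sqrt 3) <= r ->
          T r = 3 / pi * sinh r *
            atan (4 * (1 - cosh (2 * r) -
                       cosh r * Num.sqrt (2 * cosh (2 * r) - 3)) /
                  (5 * cosh (2 * r) - 2 * cosh (4 * r) -
                   8 * sinh r ^+ 2 * cosh r * Num.sqrt (2 * cosh (2 * r) - 3)
                   + 1)),
        hoelder_continuous_on `[0, +oo[ T &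
        has_density_on P (fun w => modular_dist (tau w) (@i_star R))
          `[0, +oo[ T].
Proof.
have third_ge0 : 0 <= arsinh (1 / Num.sqrt 3) :> R.
  by rewrite arsinh_ge0// divr_ge0 ?sqrtr_ge0.
exists (@density R); split.
- by move=> r /andP[r0 r1]; apply: density_near; rewrite sqr_sinh_half.
- move=> r /andP[rl rr].
  have r0 : 0 <= r by apply: le_trans rl; rewrite arsinh_ge0.
  by apply: density_middle_atan; rewrite ?half_sqr_sinh ?sqr_sinh_third.
- move=> r rl; have r0 := le_trans third_ge0 rl.
  by apply: density_far_atan; rewrite ?third_sqr_sinh.
- exact: density_hoelder.
have mball (r : R) : measurable (modular_ball r).
  exact: measurable_modular_dist_lt.
apply: has_density_of_cdf.
- exact: measurable_density.
- exact: density_ge0.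
(* It is enough to test the rays []-oo, r[], whose preimages are those of the modular balls under
   [tau]. *)
- apply: (measurability _ (RGenInftyO.measurableE R)) => _ [_ [r ->] <-].
  rewrite setTI (_ : _ @^-1` _ = tau @^-1` modular_ball r).
    by rewrite -[X in measurable X]setTI; exact: measurable_funP.
  by apply/seteqP; split=> w /=; rewrite in_itv.
- by move=> w; exact: modular_dist_ge0.
move=> r r0; rewrite -modular_dist_cdf// -tau_uniform//.
Qed.
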